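(* Let $N$ be an Orlicz function with $N(1)=1$ such that for some $r>0$ $$\inf_{0<s,t\le1}\frac{N(st)}{N(s)t^r}>0,$$ and let $1\le p\le\infty$. The following are equivalent: (i) $\ell^p$ is symmetrically block finitely represented in the unit vector basis $\{e_k\}$ of $l_N$; (ii) $\ell^p$ is symmetrically finitely represented in $l_N$; (iii) $\ell^p$ is crudely symmetrically finitely represented in $l_N$; (iv) $p\in[1/\beta,1/\alpha]$ (with $1/0=\infty$), where $$\alpha=-\lim_{n\to\infty}\frac1n\log_2\sup_{k=0,1,\dots}\frac{N^{-1}(2^{-k-n})}{N^{-1}(2^{-k})},\qquad\beta=\lim_{n\to\infty}\frac1n\log_2\sup_{k\ge n}\frac{N^{-1}(2^{-k+n})}{N^{-1}(2^{-k})}$$ are the Boyd indices of $l_N$.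
   Context: An Orlicz function is an increasing convex continuous function $N$ on $[0,\infty)$ with $N(0)=0$ and $\lim_{t\to\infty}N(t)=\infty$; $N^{-1}$ is its inverse. The Orlicz sequence space $l_N$ consists of real sequences $a$ with $\|a\|_{l_N}=\inf\{u>0:\sum_{k=1}^\infty N(|a_k|/u)\le1\}<\infty$. Sequences $x,y$ have the same ordered distribution if $y_{\pi(k)}=x_k$ for some permutation $\pi$ of $\mathbb N$; finite blocks $\sum_{i=1}^m\alpha_ie_{n_i}$, $\sum_{i=1}^m\beta_ie_{k_i}$ (increasing indices) have the same ordered distribution if $\beta_i=\alpha_{\pi(i)}$ for a permutation $\pi$ of $\{1,\dots,m\}$. $\|a\|_p$ is the $\ell^p$ norm on $\mathbb R^n$ (max norm if $p=\infty$). In a space $X$: $\ell^p$ is symmetrically block finitely represented in $\{e_k\}$ if for all $n,\varepsilon>0$ there are $0=m_0<\dots<m_n$ and reals $\alpha_i$ such that the blocks $u_k=\sum_{i=m_{k-1}+1}^{m_k}\alpha_ie_i$ pairwise have the same ordered distribution and $(1+\varepsilon)^{-1}\|a\|_p\le\|\sum a_ku_k\|_X\le(1+\varepsilon)\|a\|_p$ for all $a\in\mathbb R^n$; symmetrically finitely represented if for all $n,\varepsilon>0$ there are pairwise disjointly supported $x_1,\dots,x_n\in X$ pairwise with the same ordered distribution satisfying the same $(1+\varepsilon)$ estimate; crudely symmetrically finitely represented if for some $C>0$ and every $n$ such $x_k$ exist with $C^{-1}\|a\|_p\le\|\sum a_kx_k\|_X\le C\|a\|_p$. *)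

(* Defs.v *)
From HB Require Import structures.
From mathcomp Require Import all_boot all_order all_algebra.
From mathcomp Require Import all_classical all_reals all_analysis.
Set Implicit Arguments. Unset Strict Implicit. Unset Printing Implicit Defensive.
Import Order.TTheory GRing.Theory Num.Theory.
Import numFieldNormedType.Exports.
Local Open Scope classical_set_scope.
Local Open Scope ring_scope.

Section Orlicz.
Variable R : realType.

Definition orlicz_fun (N : R -> R) : Prop :=
  [/\ N 0 = 0,
      (forall x y, 0 <= x -> x < y -> N x < N y),
      (forall x y l, 0 <= x -> 0 <= y -> 0 <= l <= 1 ->
          N (l * x + (1 - l) * y) <= l * N x + (1 - l) * N y),
      {within `[0, +oo[, continuous N} &
      N x @[x --> +oo] --> +oo].

(* Inverse N^{-1} of an Orlicz function on [0,oo) (for u >= 0 this is the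
   unique x >= 0 with N x = u). *)
Definition orlicz_inv (N : R -> R) (u : R) : R :=
  sup [set x : R | 0 <= x /\ N x <= u].

Definition log2 (x : R) : R := ln x / ln 2.

Definition boyd_alpha (N : R -> R) : R :=
  - limn (fun n : nat => n%:R^-1 * log2 (sup
      [set orlicz_inv N (2 ^- (k + n)%N) / orlicz_inv N (2 ^- k) | k in [set: nat]])).

Definition boyd_beta (N : R -> R) : R :=
  limn (fun n : nat => n%:R^-1 * log2 (sup
      [set orlicz_inv N (2 ^- (k - n)%N) / orlicz_inv N (2 ^- k) | k in [set k : nat | (n <= k)%N]])).

Definition inv_ext (a : R) : \bar R := if a == 0 then +oo%E else (a^-1)%:E.

Definition orlicz_modular (N : R -> R) (x : nat -> R) (u : R) : \bar R :=
  (\sum_(k <oo) (N (`|x k| / u))%:E)%E.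

Definition in_lN (N : R -> R) (x : nat -> R) : Prop :=
  exists u : R, 0 < u /\ (orlicz_modular N x u <= 1)%E.

Definition lN_norm (N : R -> R) (x : nat -> R) : R :=
  inf [set u : R | 0 < u /\ (orlicz_modular N x u <= 1)%E].

Definition lp_norm (p : \bar R) (n : nat) (a : 'I_n -> R) : R :=
  match p with
  | +oo%E => \big[Num.max/0]_(i < n) `|a i|
  | r%:E => (\sum_(i < n) `|a i| `^ r) `^ r^-1
  | -oo%E => 0
  end.

Definition lincomb (n : nat) (a : 'I_n -> R) (x : 'I_n -> nat -> R) : nat -> R :=
  fun i => \sum_(k < n) a k * x k i.

Definition same_odist (x y : nat -> R) : Prop :=
  exists pi : nat -> nat, bijective pi /\ forall k, y (pi k) = x k.

Definition lp_equiv (N : R -> R) (p : \bar R) (C : R) (n : nat)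
    (x : 'I_n -> nat -> R) : Prop :=
  forall a : 'I_n -> R,
    C^-1 * lp_norm p a <= lN_norm N (lincomb a x) <= C * lp_norm p a.

Definition block (alpha : nat -> R) (b e : nat) : nat -> R :=
  fun i => if (b <= i < e)%N then alpha i else 0.

Definition sym_block_fin_rep (N : R -> R) (p : \bar R) : Prop :=
  forall (n : nat) (eps : R), 0 < eps ->
  exists (m : nat -> nat) (alpha : nat -> R),
    [/\ m 0%N = 0%N,
        (forall k, (k < n)%N -> (m k < m k.+1)%N),
        (forall j k : 'I_n,
           (m j.+1 - m j = m k.+1 - m k)%N /\
           perm_eq [seq alpha i | i <- iota (m j) (m j.+1 - m j)%N]
                   [seq alpha i | i <- iota (m k) (m k.+1 - m k)%N]) &
        lp_equiv N p (1 + eps) (fun k : 'I_n => block alpha (m k) (m k.+1))].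

Definition sym_vectors (N : R -> R) (n : nat) (x : 'I_n -> nat -> R) : Prop :=
  [/\ (forall k, in_lN N (x k)),
      (forall j k : 'I_n, j != k -> forall i, x j i = 0 \/ x k i = 0) &
      (forall j k : 'I_n, same_odist (x j) (x k))].

Definition sym_fin_rep (N : R -> R) (p : \bar R) : Prop :=
  forall (n : nat) (eps : R), 0 < eps ->
  exists x : 'I_n -> nat -> R, sym_vectors N x /\ lp_equiv N p (1 + eps) x.

Definition crude_sym_fin_rep (N : R -> R) (p : \bar R) : Prop :=
  exists C : R, 0 < C /\
  forall n : nat, exists x : 'I_n -> nat -> R, sym_vectors N x /\ lp_equiv N p C x.

End Orlicz.

(* Main.v *)
(** Write p = 1/s (s = 0 for p = oo). Call N minorized (majorized) by the power
    q if N(st) >= c N(s) t^q (resp. N(st) <= K N(s) t^q) on the unit square.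
    Both Boyd limits are growth rates of suprema of multiplicative cocycles, so
    Fekete's lemma identifies 1/alpha and 1/beta with the critical powers for
    minorization and majorization.

    If disjoint equidistributed x_1, ..., x_n are equivalent to the l^p basis,
    testing on x_1 and x_1 + ... + x_n shows that the modular
    F(t) = sum_i N(t |x_1(i)|) drops by a factor comparable to n when t is
    divided by n^s.  Every power q minorizing N then satisfies s q >= 1 and
    every majorizing one s q <= 1, whence p lies in [1/beta, 1/alpha].

    Conversely, put h_j = N(th^j) th^(-pj) with th < 1 close to 1. Unless h is
    eventually uniformly exponentially increasing or decreasing, which the
    position of p excludes, there are arbitrarily remote intervals [a, b) with
    h_a + h_b small compared with sum_{a <= j < b} h_j. The combination
    sum_{a <= j < b} th^(-pj) N(t th^j), suitably normalized, is then almost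
    t^p, because replacing t by t th^i only shifts the interval. Rounding the
    coefficients to integers costs at most sum_{j >= a} th^j, so the block which
    repeats th^j with these multiplicities has a modular uniformly close to a
    multiple of t^p on [0, 1], and its translates span l^p almost
    isometrically. *)

Require Import Defs.
From HB Require Import structures.
From mathcomp Require Import all_boot all_order all_algebra.
From mathcomp Require Import all_classical all_reals all_analysis.
From mathcomp Require Import ring lra zify.
Set Implicit Arguments. Unset Strict Implicit. Unset Printing Implicit Defensive.
Import Order.TTheory GRing.Theory Num.Theory.
Import numFieldNormedType.Exports.
Local Open Scope classical_set_scope.
Local Open Scope ring_scope.

(** * Real sequences *)

Section RealSequences.
Variable R : realType.
Implicit Types (u h : nat -> R) (x e : R).

Lemma exists_expr_lt x e : 0 <= x < 1 -> 0 < e -> exists n, x ^+ n < e.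
Proof.
move=> /andP[x0 x1] e0.
have /cvgr_lt/(_ _ e0)[n _ nP] : x ^+ n @[n --> \oo] --> (0 : R).
  by apply: cvg_expr; rewrite ger0_norm.
by exists n; apply: nP => /=.
Qed.

Lemma le_eps_pos (x y : R) : (forall e, 0 < e -> x <= y + e) -> x <= y.
Proof. by move=> H; apply/ler_addgt0Pr => e /H. Qed.

(** Write n = q m + k with k < m. Subadditivity gives u n <= q (u m) + u k, and D absorbs the
    finitely many values u k together with the discrepancy between q m and n. *)
Lemma subadditive_linear_bound u : (forall m n, u (m + n)%N <= u m + u n) ->
  forall m, (0 < m)%N -> exists D, forall n, u n <= n%:R * (m%:R^-1 * u m) + D.
Proof.
move=> uD m m0; set l := m%:R^-1 * u m.
have um : u m = m%:R * l by rewrite /l mulrA divff ?mul1r// pnatr_eq0 -lt0n.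
exists (\sum_(k < m) `|u k| + m%:R * `|l|) => n.
have uqr q k : u (q * m + k)%N <= q%:R * u m + u k.
  elim: q => [|q IH]; first by rewrite mul0n mul0r add0r.
  rewrite mulSn -addnA (le_trans (uD _ _))// -natr1 mulrDl mul1r.
  lra.
rewrite {1}(divn_eq n m) (le_trans (uqr _ _))// um.
have nm : n%:R = (n %/ m)%:R * m%:R + (n %% m)%:R :> R.
  by rewrite {1}(divn_eq n m) natrD natrM.
have lt_r : (n %% m < m)%N by rewrite ltn_mod.
have h1 : u (n %% m)%N <= \sum_(k < m) `|u k|.
  rewrite (bigD1 (Ordinal lt_r))//= (le_trans (ler_norm _))// lerDl sumr_ge0//.
have h2 : - ((n %% m)%:R * l) <= m%:R * `|l|.
  apply: le_trans (_ : (n %% m)%:R * `|l| <= _).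
    by rewrite -mulrN ler_wpM2l// -normrN ler_norm.
  by rewrite ler_wpM2r// ler_nat ltnW.
by rewrite nm mulrDl -mulrA; lra.
Qed.

(** The limit is the infimum of u n / n over positive n, finite by the linear lower bound: any
    single u m / m bounds all later quotients up to an error D / n. *)
Lemma fekete u C : (forall m n, u (m + n)%N <= u m + u n) ->
  (forall n, C * n%:R <= u n) ->
  cvgn (fun n => n%:R^-1 * u n) /\
  forall n, (0 < n)%N -> limn (fun n => n%:R^-1 * u n) <= n%:R^-1 * u n.
Proof.
move=> uD uC; set v := fun n => _.
(* Index 0 is left out: [0^-1 = 0] makes [v 0] equal to 0, which need not lie above the limit. *)
set S := [set v n | n in [set k | (0 < k)%N]].
have S0 : S !=set0 by exists (v 1%N); exists 1%N.
have Slb : has_lbound S.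
  exists C => _ [n /= n0 <-].
  by rewrite /v mulrC ler_pdivlMr ?ltr0n.
have infS n : (0 < n)%N -> inf S <= v n by move=> n0; apply: ge_inf => //; exists n.
have vS : v n @[n --> \oo] --> inf S.
  apply/cvgrPdist_lt => e e0.
  have [|_ [m /= m0 <-] vm] := @inf_adherent _ S (e / 2) _ (conj S0 Slb); first by rewrite divr_gt0.
  have [D uDm] := subadditive_linear_bound uD m0.
  pose M := Num.bound (`|D| / (e / 2)).
  exists M.+1 => // n /= Mn.
  have n0 : (0 < n)%N by exact: leq_trans Mn.
  have nR : 0 < n%:R :> R by rewrite ltr0n.
  rewrite distrC ger0_norm ?subr_ge0 ?infS//.
  have : v n <= v m + D / n%:R.
    rewrite /v mulrC ler_pdivrMr// mulrDl divfK ?gt_eqF// [_ * n%:R]mulrC.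
    exact: uDm.
  have : D / n%:R < e / 2.
    rewrite ltr_pdivrMr// mulrC -ltr_pdivrMr ?divr_gt0//.
    apply: le_lt_trans (_ : `|D| / (e / 2) < _).
      by rewrite ler_pM2r ?ler_norm// invr_gt0 divr_gt0.
    apply: lt_trans (archi_boundP _) _; first by rewrite divr_ge0// ltW// divr_gt0.
    by rewrite ltr_nat.
  lra.
split; first by apply/cvg_ex; exists (inf S).
by move=> n n0; rewrite (cvg_lim _ vS)//; exact: infS.
Qed.

(* If the partial sums S diverge, the hypothesis with a = J makes them grow
   geometrically; if they converge, letting b tend to infinity makes the tails
   decay geometrically. *)
Lemma endpoint_dichotomy h (eta : R) (J : nat) :
  (forall j, 0 < h j) -> 0 < eta <= 1 ->
  (forall a b, (J <= a < b)%N -> eta * \sum_(a <= j < b) h j < h a + h b) ->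
  exists (b0 : nat) (d c : R), 0 < d < 1 /\ 0 < c /\
    ((forall b i, (b0 <= b)%N -> c * (1 + d) ^+ i * h b <= h (b + i)%N) \/
     (forall b i, (b0 <= b)%N -> h (b + i)%N <= c * (1 - d) ^+ i * h b)).
Proof.
move=> h0 /andP[e0 e1] he; pose S n := \sum_(J <= j < n) h j.
have SS n : (J <= n)%N -> S n.+1 = S n + h n by move=> Jn; rewrite /S big_nat_recr.
have S_mono m n : (J <= m <= n)%N -> S m <= S n.
  move=> /andP[Jm mn]; rewrite /S (big_cat_nat _ mn)//= lerDl sumr_ge0// => i _.
  exact: ltW.
have S_split a b : (J <= a <= b)%N -> \sum_(a <= j < b) h j = S b - S a.
  by move=> /andP[Ja ab]; rewrite /S (big_cat_nat Ja ab)/=; lra.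
have [[B SB]|] := pselect (exists B, forall n, S n <= B).
  pose T := sup (range S).
  have rS : has_sup (range S).
    by split; [exists (S 0%N); exists 0%N|exists B => _ [n _ <-]].
  have ST n : S n <= T by apply: ub_le_sup; [exact: rS.2|exists n].
  (* Take b with S b within d / 2 of T. Then h b, being at most T - S b, is negligible, and so is
     the part of the tail beyond b. *)
  have hT a : (J <= a)%N -> eta * (T - S a) <= h a.
    move=> Ja; apply: le_eps_pos => d d0.
    have [_ [b0 _ <-] Tb0] := sup_adherent (divr_gt0 d0 (ltr0n _ 2)) rS.
    pose b := maxn b0 a.+1.
    have Sb : T - d / 2 < S b.
      have [Jb0|] := leqP J b0.
        by apply: (lt_le_trans Tb0); apply: S_mono; rewrite Jb0 leq_maxl.
      move=> b0J; apply: (lt_le_trans Tb0).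
      have -> : S b0 = 0 by rewrite /S big_geq// ltnW.
      by apply: sumr_ge0 => i _; exact: ltW.
    have ab : (J <= a < b)%N by rewrite Ja leq_maxr.
    have Jb : (J <= b)%N by lia.
    have := he _ _ ab; rewrite S_split; last by lia.
    have := ST b.+1; rewrite SS// => h1.
    have : eta * (T - S a) <= eta * (S b - S a) + d / 2.
      have : eta * (T - S b) <= 1 * (T - S b).
        by rewrite ler_wpM2r// subr_ge0.
      lra.
    lra.
  (* By [hT] each step removes at least the fraction eta of the tail T - S; halving eta keeps 1 - d
     positive. *)
  exists J, (eta / 2), eta^-1; split; first by lra.
  split; first by rewrite invr_gt0.
  right => b i Jb.
  have Ti j : T - S (b + j)%N <= (1 - eta / 2) ^+ j * (T - S b).
    elim: j => [|j IH]; first by rewrite addn0 expr0 mul1r.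
    have Jbj : (J <= b + j)%N by lia.
    rewrite addnS SS// exprS -mulrA.
    apply: le_trans (_ : (1 - eta / 2) * (T - S (b + j)%N) <= _); last first.
      by apply: ler_wpM2l => //; lra.
    have := hT _ Jbj; have := ST (b + j)%N.
    have := h0 (b + j)%N; nra.
  have hle : h (b + i)%N <= T - S (b + i)%N.
    have := ST (b + i).+1; rewrite SS; last by lia.
    lra.
  apply: (le_trans hle); apply: (le_trans (Ti i)).
  rewrite [_ * _ ^+ i]mulrC -mulrA ler_wpM2l//.
    by rewrite exprn_ge0//; lra.
  by rewrite mulrC ler_pdivlMr// mulrC; exact: hT.
move=> SB.
(* The size of S b0 makes h J at most half of eta * S b for b >= b0, so the other endpoint h b must
   carry the remaining half. *)
have [b0 [Jb0 Sb0]] : exists b0, (J < b0)%N /\ 2 * h J / eta <= S b0.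
  have [n Sn] : exists n, 2 * h J / eta < S n.
    apply: contrapT => H; apply: SB; exists (2 * h J / eta) => n.
    by rewrite leNgt; apply/negP => ?; apply: H; exists n.
  exists (maxn J.+1 n); split; first by rewrite leq_maxl.
  have [Jn|nJ] := leqP J n.
    by rewrite ltW// (lt_le_trans Sn)// S_mono// Jn leq_maxr.
  have S0 : S n = 0 by rewrite /S big_geq// ltnW.
  by rewrite ltW// (lt_le_trans Sn)// S0; apply: sumr_ge0 => i _; exact: ltW.
have hS b : (b0 <= b)%N -> eta / 2 * S b <= h b.
  move=> b0b; have Jb : (J <= J < b)%N by lia.
  have := he _ _ Jb; rewrite -/(S b).
  have : 2 * h J / eta <= S b by apply: (le_trans Sb0); apply: S_mono; lia.
  rewrite ler_pdivrMr//; lra.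
have Si b i : (b0 <= b)%N -> (1 + eta / 2) ^+ i * S b <= S (b + i)%N.
  move=> b0b; elim: i => [|i IH]; first by rewrite addn0 expr0 mul1r.
  rewrite addnS SS; last by lia.
  have b0bi : (b0 <= b + i)%N by lia.
  have := hS _ b0bi; rewrite exprS -mulrA.
  have : (1 + eta / 2) * ((1 + eta / 2) ^+ i * S b) <= (1 + eta / 2) * S (b + i)%N.
    by apply: ler_wpM2l => //; lra.
  lra.
exists b0.+1, (eta / 2), (eta / 2 / (1 + eta / 2)); split; first by lra.
split; first by rewrite divr_gt0//; lra.
(* For a positive offset the comparison is with S b.+1, which contains h b; this loses one factor 1
   + d, whence the denominator of c. *)
left => b [|i] b0b; have dp : 0 < 1 + eta / 2 by lra.
  rewrite addn0 expr0 mulr1 ler_piMl ?(ltW (h0 _))// ler_pdivrMr//; lra.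
have b0bi : (b0 <= b + i.+1)%N by lia.
apply: le_trans (hS _ b0bi).
rewrite exprS mulrA divfK ?gt_eqF// -mulrA ler_wpM2l//; first by lra.
rewrite addnS -addSn; apply: le_trans (Si b.+1 i _); last by lia.
apply: ler_wpM2l; first by rewrite exprn_ge0// ltW.
by rewrite SS ?lerDr; [apply: sumr_ge0 => j _; exact: ltW|lia].
Qed.

End RealSequences.

(** * Growth rates of cocycles *)

Section PowerGrowth.
Variable R : realType.
Implicit Types (s : nat -> nat -> R) (x y l : R).

Lemma log2_le x y : 0 < x -> (log2 x <= y) = (x <= 2 `^ y).
Proof.
move=> x0; have l2 : 0 < ln (2 : R) by rewrite ln_gt0// ltr1n.
by rewrite /log2 ler_pdivrMr// -[RHS]ler_ln ?posrE ?powR_gt0// ln_powR.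
Qed.

Lemma log2_ge x y : 0 < x -> (y <= log2 x) = (2 `^ y <= x).
Proof.
move=> x0; have l2 : 0 < ln (2 : R) by rewrite ln_gt0// ltr1n.
by rewrite /log2 ler_pdivlMr// -[RHS]ler_ln ?posrE ?powR_gt0// ln_powR.
Qed.

Lemma log2K x : 0 < x -> 2 `^ log2 x = x.
Proof.
move=> x0; have l2 : 0 < ln (2 : R) by rewrite ln_gt0// ltr1n.
by rewrite /powR pnatr_eq0/= /log2 divfK ?gt_eqF// lnK.
Qed.

Lemma powR_le_root t q y : 0 <= t -> 0 < q -> t `^ q <= y -> t <= y `^ q^-1.
Proof.
move=> t0 q0 ty; rewrite -[leLHS](powRr1 t0) -(mulfV (lt0r_neq0 q0)) powRrM.
apply: ge0_ler_powR => //; rewrite ?nnegrE ?invr_ge0 ?powR_ge0 ?(ltW q0)//.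
by rewrite (le_trans _ ty)// powR_ge0.
Qed.

Lemma exists_expr_bracket (th u : R) : 0 < th < 1 -> 0 < u <= 1 ->
  exists k, th ^+ k.+1 < u <= th ^+ k.
Proof.
move=> /andP[th0 th1] /andP[u0 u1].
have ex : exists n, th ^+ n < u by apply: exists_expr_lt => //; rewrite th1 ltW.
case: (ex_minnP ex) => -[|k] kP kmin; first by move: kP; rewrite expr0 ltNge u1.
exists k; rewrite kP/= leNgt; apply/negP => /kmin; rewrite ltnn//.
Qed.

(** The cocycle identity makes the logarithms of the suprema subadditive, and the two-sided bound
    makes them finite and linearly bounded below, so L is an infimum. One index with mean below l
    therefore yields the exponential bound; conversely K contributes only log2 K / n, which vanishes
    in the limit. *)
Lemma log2_sup_cocycle s :
    (forall j m n, s j (m + n)%N = s j m * s (j + m)%N n) ->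
    (forall j n, 2 ^- n <= s j n <= 2 ^+ n) ->
  let L := limn (fun n => n%:R^-1 * log2 (sup [set s j n | j in [set: nat]])) in
  forall l,
    (L < l -> exists2 K, 0 < K & forall j n, s j n <= K * 2 `^ (l * n%:R)) /\
    ((exists2 K, 0 < K & forall j n, s j n <= K * 2 `^ (l * n%:R)) -> L <= l).
Proof.
move=> sD sB L l; pose W n := sup [set s j n | j in [set: nat]].
pose u n := log2 (W n).
have s0 j n : 0 < s j n.
  by case/andP: (sB j n) => + _; apply: lt_le_trans; rewrite invr_gt0 exprn_gt0.
have hub n : has_ubound [set s j n | j in [set: nat]].
  by exists (2 ^+ n) => _ [j _ <-]; case/andP: (sB j n).
have sW j n : s j n <= W n by apply: ub_le_sup => //; exists j.
have Wle n y : (forall j, s j n <= y) -> W n <= y.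
  move=> H; apply: ge_sup; first by exists (s 0%N n); exists 0%N.
  by move=> _ [j _ <-].
have W0 n : 0 < W n by apply: lt_le_trans (s0 0%N n) (sW _ _).
have uD m n : u (m + n)%N <= u m + u n.
  rewrite /u log2_le// powRD; last by rewrite pnatr_eq0 implybT.
  rewrite !log2K//; apply: Wle => j; rewrite sD.
  by rewrite ler_pM// ltW.
have uB n : -1 * n%:R <= u n.
  rewrite mulN1r log2_ge// powRN powR_mulrn//.
  by apply: le_trans (sW 0%N n); case/andP: (sB 0%N n).
have [ucvg Lu] := fekete uD uB.
split=> [Ll|[K K0 sK]].
  have /cvgr_lt/(_ _ Ll)[n0 _ n0P] : (n%:R^-1 * u n) @[n --> \oo] --> L by [].
  have /= un0 := n0P n0.+1 (leqnSn _).
  have [D uDm] := subadditive_linear_bound uD (ltn0Sn n0).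
  exists (2 `^ D); first exact: powR_gt0.
  move=> j n; apply: (le_trans (sW j n)).
  rewrite -powRD; last by rewrite pnatr_eq0 implybT.
  rewrite -log2_le//; apply: (le_trans (uDm n)).
  by rewrite addrC lerD2l mulrC ler_wpM2r// ltW.
apply: le_eps_pos => e e0.
pose M := log2 K.
pose n := (Num.bound (`|M| / e)).+1.
have n0 : 0 < n%:R :> R by rewrite ltr0n.
have Mn : `|M| < e * n%:R.
  rewrite mulrC -ltr_pdivrMr//; apply: (@lt_trans _ _ (Num.bound (`|M| / e))%:R).
    by apply: archi_boundP; rewrite divr_ge0// ltW.
  by rewrite ltr_nat.
apply: (le_trans (Lu n _)) => //.
rewrite mulrC ler_pdivrMr// mulrDl.
rewrite /u log2_le// powRD; last by rewrite pnatr_eq0 implybT.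
apply: Wle => j; apply: (le_trans (sK j n)); rewrite mulrC ler_wpM2l ?powR_ge0//.
by rewrite -log2_le// (le_trans (ler_norm _))// ltW.
Qed.

End PowerGrowth.

(** * Orlicz functions and Boyd indices *)

Section OrliczFunction.
Variables (R : realType) (N : R -> R).
Hypotheses (NO : orlicz_fun N) (N1 : N 1 = 1).
Implicit Types (x y s t u q : R) (k n : nat).

Lemma orlicz_fun0 : N 0 = 0. Proof. by case: NO. Qed.

Lemma orlicz_fun_lt x y : 0 <= x -> x < y -> N x < N y.
Proof. by case: NO => _ + _ _ _; exact. Qed.

Lemma orlicz_fun_le x y : 0 <= x -> x <= y -> N x <= N y.
Proof.
by move=> x0; rewrite le_eqVlt => /predU1P[->//|/(orlicz_fun_lt x0)/ltW].
Qed.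

Lemma orlicz_fun_le_inv x y : 0 <= y -> N x <= N y -> x <= y.
Proof.
by move=> y0 Nxy; rewrite leNgt; apply/negP => /(orlicz_fun_lt y0); rewrite ltNge Nxy.
Qed.

Lemma orlicz_fun_gt0 x : 0 < x -> 0 < N x.
Proof. by move=> x0; rewrite -orlicz_fun0 orlicz_fun_lt. Qed.

Lemma orlicz_fun_ge0 x : 0 <= x -> 0 <= N x.
Proof. by move=> x0; rewrite -orlicz_fun0 orlicz_fun_le. Qed.

Lemma orlicz_fun_contract l x : 0 <= l <= 1 -> 0 <= x -> N (l * x) <= l * N x.
Proof.
move=> l01 x0; case: NO => _ _ + _ _ => /(_ x 0 l x0 (lexx _) l01).
by rewrite orlicz_fun0 !mulr0 !addr0.
Qed.

Lemma orlicz_fun_le_id x : 0 <= x <= 1 -> N x <= x.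
Proof.
by move=> x01; rewrite -[x in N x]mulr1 -[leRHS]mulr1 -{2}N1 orlicz_fun_contract.
Qed.

Lemma orlicz_inv_fun x : 0 <= x -> orlicz_inv N (N x) = x.
Proof.
move=> x0; apply/eqP; rewrite eq_le; apply/andP; split.
  by apply: ge_sup; [exists x => /=|move=> y [_ /orlicz_fun_le_inv]; apply].
apply: ub_le_sup => //=; exists x => y [_ /orlicz_fun_le_inv]; exact.
Qed.

Lemma orlicz_fun_surj u : 0 <= u <= 1 -> exists2 x, 0 <= x <= 1 & N x = u.
Proof.
move=> u01; have [x] : exists2 x, x \in `[0, 1] & N x = u.
  apply: IVT => //.
    case: NO => _ _ _ + _; apply: continuous_subspaceW => x /=.
    by rewrite !in_itv/= => /andP[->].
  by rewrite orlicz_fun0 N1 min_l// max_r.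
by rewrite in_itv/=; exists x.
Qed.

Lemma orlicz_invK u : 0 <= u <= 1 -> N (orlicz_inv N u) = u.
Proof. by case/orlicz_fun_surj => x /andP[x0 x1] <-; rewrite orlicz_inv_fun. Qed.

Lemma orlicz_inv_itv u : 0 < u <= 1 -> 0 < orlicz_inv N u <= 1.
Proof.
move=> /andP[u0 u1]; have [|x /andP[x0 x1] Nx] := @orlicz_fun_surj u.
  by rewrite ltW.
rewrite -Nx orlicz_inv_fun// x1 andbT lt_neqAle x0 andbT; apply/eqP => x00.
by move: u0; rewrite -Nx -x00 orlicz_fun0 ltxx.
Qed.

(** * Dyadic values of the inverse and the Boyd indices *)

Let g k := orlicz_inv N (2 ^- k).

Lemma half_expr_itv k : 0 < (2 ^- k : R) <= 1.
Proof. by rewrite invr_gt0 exprn_gt0//= invf_le1 ?exprn_gt0// exprn_ege1// ler1n. Qed.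

Lemma orlicz_inv_dyadic k : [/\ 0 < g k, g k <= 1 & N (g k) = 2 ^- k].
Proof.
have h := half_expr_itv k; have /andP[? ?] := orlicz_inv_itv h.
by split => //; rewrite orlicz_invK//; case/andP: h => /ltW -> ->.
Qed.

(** The lower bound is convexity: N (2^-n x) <= 2^-n N x, so dividing the value by 2^n divides the
    argument by at most 2^n. *)
Lemma orlicz_inv_dyadic_ratio k n : 2 ^- n <= g (k + n) / g k <= 1.
Proof.
have [a0 a1 Na] := orlicz_inv_dyadic k; have [b0 b1 Nb] := orlicz_inv_dyadic (k + n).
have /andP[h0 h1] := half_expr_itv n.
rewrite ler_pdivlMr// ler_pdivrMr// mul1r; apply/andP; split.
  apply: orlicz_fun_le_inv (ltW b0) _; rewrite Nb exprD invfM -Na [leRHS]mulrC.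
  by apply: orlicz_fun_contract; rewrite ?(ltW h0)// ltW.
by apply: orlicz_fun_le_inv (ltW a0) _; rewrite Na Nb exprD invfM ler_piMr.
Qed.

(** Discretizes an argument at the cost of a factor 2 both in N s, by the choice of k, and in s,
    because g k.+1 >= g k / 2. *)
Lemma dyadic_level s : 0 < s <= 1 ->
  exists k, 2 ^- k.+1 < N s <= 2 ^- k /\ g k / 2 <= s <= g k.
Proof.
move=> /andP[s0 s1].
have [||k] := @exists_expr_bracket _ 2^-1 (N s).
- by rewrite invr_gt0 ltr0n/= invf_lt1 ?ltr1n.
- by rewrite orlicz_fun_gt0//= -N1 orlicz_fun_le// ltW.
rewrite !exprVn => /andP[lNs Nsu]; exists k; rewrite lNs Nsu; split=> //.
have [a0 a1 Na] := orlicz_inv_dyadic k; have [b0 b1 Nb] := orlicz_inv_dyadic k.+1.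
rewrite (orlicz_fun_le_inv (ltW a0)) ?Na// andbT.
apply: (@le_trans _ _ (g k.+1)).
  have /andP[+ _] := orlicz_inv_dyadic_ratio k 1.
  by rewrite expr1 ler_pdivlMr// mulrC addn1.
by apply: orlicz_fun_le_inv (ltW s0) _; rewrite Nb ltW.
Qed.

Lemma boyd_alpha_cocycle l :
  (- boyd_alpha N < l ->
    exists2 K, 0 < K & forall j n, g (j + n) / g j <= K * 2 `^ (l * n%:R)) /\
  ((exists2 K, 0 < K & forall j n, g (j + n) / g j <= K * 2 `^ (l * n%:R)) ->
    - boyd_alpha N <= l).
Proof.
rewrite /boyd_alpha opprK.
apply: (@log2_sup_cocycle _ (fun j n => g (j + n) / g j)) => [j m n|j n].
  have [a0 _ _] := orlicz_inv_dyadic (j + m).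
  by rewrite addnA [RHS]mulrC mulrA divfK ?gt_eqF.
have /andP[-> h] := orlicz_inv_dyadic_ratio j n.
by rewrite (le_trans h)// exprn_ege1// ler1n.
Qed.

Lemma boyd_beta_cocycle l :
  (boyd_beta N < l ->
    exists2 K, 0 < K & forall j n, g j / g (j + n) <= K * 2 `^ (l * n%:R)) /\
  ((exists2 K, 0 < K & forall j n, g j / g (j + n) <= K * 2 `^ (l * n%:R)) ->
    boyd_beta N <= l).
Proof.
(* Substituting k = j + n removes the truncated subtraction and leaves the inverse of the cocycle
   used for alpha. *)
have -> : boyd_beta N = limn (fun n => n%:R^-1 * log2 (sup
    [set g j / g (j + n) | j in [set: nat]])).
  congr (limn _); apply/funext => n; congr (_ * log2 (sup _)).
  apply/seteqP; split=> _ [k /= kn <-].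
    by exists (k - n)%N => //=; rewrite subnK.
  by exists (k + n)%N => /=; rewrite ?leq_addl// addnK.
apply: (@log2_sup_cocycle _ (fun j n => g j / g (j + n))) => [j m n|j n].
  have [a0 _ _] := orlicz_inv_dyadic (j + m).
  by rewrite addnA mulrA divfK ?gt_eqF.
have [a0 _ _] := orlicz_inv_dyadic j; have [b0 _ _] := orlicz_inv_dyadic (j + n).
have /andP[h1 h2] := orlicz_inv_dyadic_ratio j n.
have h0 : 0 < 2 ^- n :> R by case/andP: (half_expr_itv n).
rewrite -invf_div; apply/andP; split.
  apply: (@le_trans _ _ 1); first by case/andP: (half_expr_itv n).
  by rewrite -[leLHS]invr1 lef_pV2 ?posrE// divr_gt0.
by rewrite -[leRHS]invrK lef_pV2 ?posrE// divr_gt0.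
Qed.

(** For q = r this is the growth hypothesis on N. The critical exponents of this condition and of
    [pow_majorant] are the Matuszewska-Orlicz indices of N at zero. *)
Definition pow_minorant q := exists2 c : R, 0 < c &
  forall s t, 0 < s <= 1 -> 0 < t <= 1 -> c * (N s * t `^ q) <= N (s * t).

Definition pow_majorant q := exists2 K : R, 0 < K &
  forall s t, 0 < s <= 1 -> 0 < t <= 1 -> N (s * t) <= K * (N s * t `^ q).

(** Test on s = g j and s t = g (j + n), where N drops by exactly 2^-n: then c t^q <= 2^-n, so the
    ratio t is at most a multiple of 2^(-n/q). *)
Lemma pow_minorant_boyd_alpha q : 0 < q -> pow_minorant q -> q^-1 <= boyd_alpha N.
Proof.
move=> q0 [c c0 Nq]; rewrite -[leRHS]opprK lerNr.
apply: (boyd_alpha_cocycle _).2; exists (c^-1 `^ q^-1).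
  by rewrite powR_gt0// invr_gt0.
move=> j n; have [a0 a1 Na] := orlicz_inv_dyadic j.
have [b0 b1 Nb] := orlicz_inv_dyadic (j + n).
have /andP[_ t1] := orlicz_inv_dyadic_ratio j n.
have t0 : 0 < g (j + n) / g j by rewrite divr_gt0.
have -> : - q^-1 * n%:R = - n%:R * q^-1 by ring.
rewrite powRrM powR_invn// -powRM ?invr_ge0 ?exprn_ge0 ?(ltW c0)//.
apply: powR_le_root (ltW t0) q0 _; rewrite ler_pdivlMl//.
have := Nq (g j) (g (j + n) / g j); rewrite a0 a1 t0 t1 => /(_ isT isT).
by rewrite [g j * _]mulrC divfK ?gt_eqF// Na Nb exprD invfM mulrCA ler_pM2l// invr_gt0 exprn_gt0.
Qed.

(** The same test points give 2^-n <= K t^q, which bounds 1 / t by a multiple of 2^(n/q). *)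
Lemma pow_majorant_boyd_beta q : 0 < q -> pow_majorant q -> boyd_beta N <= q^-1.
Proof.
move=> q0 [K K0 Nq]; apply: (boyd_beta_cocycle _).2; exists (K `^ q^-1).
  by rewrite powR_gt0.
move=> j n; have [a0 a1 Na] := orlicz_inv_dyadic j.
have [b0 b1 Nb] := orlicz_inv_dyadic (j + n).
have /andP[_ t1] := orlicz_inv_dyadic_ratio j n.
have t0 : 0 < g (j + n) / g j by rewrite divr_gt0.
rewrite [q^-1 * _]mulrC powRrM powR_mulrn// -powRM ?exprn_ge0 ?(ltW K0)//.
have s0 : 0 < g j / g (j + n) by rewrite divr_gt0.
apply: powR_le_root (ltW s0) q0 _.
rewrite -invf_div -powR_inv1 ?(ltW t0)// powRAC powR_inv1 ?powR_ge0//.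
rewrite -[leLHS]mul1r ler_pdivrMr ?powR_gt0//.
have := Nq (g j) (g (j + n) / g j); rewrite a0 a1 t0 t1 => /(_ isT isT).
rewrite [g j * _]mulrC divfK ?gt_eqF// Na Nb exprD invfM mulrCA ler_pM2l ?invr_gt0 ?exprn_gt0//.
rewrite -(ler_pM2l (exprn_gt0 n (ltr0n _ 2))) divff ?expf_neq0//.
by rewrite mulrCA mulrA.
Qed.

(** Put s and s t at dyadic levels k <= l. The decay of g gives t <= 2 K 2^(-a (l - k)), the 2
    coming from g k <= 2 s; raised to the power 1/a this compares t^(1/a) with 2^-(l - k), which is
    N (s t) / N s up to a factor 2. *)
Lemma boyd_alpha_pow_minorant a : 0 < a -> a < boyd_alpha N -> pow_minorant a^-1.
Proof.
move=> a0 aN; have [|K K0 gK] := (boyd_alpha_cocycle (- a)).1; first by rewrite ltrN2.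
exists ((2 * K) `^ a^-1 * 2)^-1; first by rewrite invr_gt0 mulr_gt0 ?powR_gt0 ?mulr_gt0.
move=> s t s01 t01; have /andP[s0 s1] := s01; have /andP[t0 t1] := t01.
rewrite ler_pdivrMl ?mulr_gt0 ?powR_gt0 ?mulr_gt0//.
have st01 : 0 < s * t <= 1 by rewrite mulr_gt0//= mulr_ile1// ltW.
have [k [/andP[k1 k2] /andP[k3 k4]]] := dyadic_level s01.
have [l [/andP[l1 l2] /andP[l3 l4]]] := dyadic_level st01.
have kl : (k <= l)%N.
  have : 2 ^- l.+1 < 2 ^- k :> R.
    apply: lt_le_trans l1 (le_trans _ k2).
    by apply: orlicz_fun_le; [rewrite mulr_ge0// ltW|rewrite ler_piMr// ltW].
  rewrite ltf_pV2 ?posrE ?exprn_gt0// ltr_eXn2l ?ltr1n//.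
have [gk0 _ _] := orlicz_inv_dyadic k; have [gl0 _ _] := orlicz_inv_dyadic l.
have tle : t <= 2 * K * 2 `^ (- a * (l - k)%:R).
  rewrite -mulrA -(ler_pM2l s0); apply: (le_trans l4).
  have := gK k (l - k)%N; rewrite subnKC// ler_pdivrMr// => /le_trans; apply.
  have : 0 <= K * 2 `^ (- a * (l - k)%:R) by rewrite mulr_ge0 ?powR_ge0// ltW.
  set X := K * _ => X0; nra.
have {}tle : t `^ a^-1 <= (2 * K) `^ a^-1 * 2 ^- (l - k).
  apply: le_trans (_ : (2 * K * 2 `^ (- a * (l - k)%:R)) `^ a^-1 <= _).
    apply: ge0_ler_powR => //; rewrite ?nnegrE ?invr_ge0 ?mulr_ge0 ?powR_ge0 ?(ltW a0)// ltW//.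
  rewrite powRM ?mulr_ge0 ?powR_ge0 ?(ltW K0)// -powRrM mulrAC mulNr divff ?gt_eqF//.
  by rewrite mulN1r powR_invn.
apply: (@le_trans _ _ (2 ^- k * ((2 * K) `^ a^-1 * 2 ^- (l - k)))).
  by apply: ler_pM => //; rewrite ?powR_ge0 ?orlicz_fun_ge0// ltW.
rewrite mulrCA -invfM -exprD subnKC// -mulrA ler_wpM2l ?powR_ge0//.
rewrite -ler_pdivrMl// -invfM -exprS ltW//.
Qed.

(** Mirror image of the previous argument: the levels k <= l of s and s t now bound t from below,
    using s <= g k and g l <= 2 s t. *)
Lemma boyd_beta_pow_majorant b : 0 < b -> boyd_beta N < b -> pow_majorant b^-1.
Proof.
move=> b0 bN; have [//|K K0 gK] := (boyd_beta_cocycle b).1.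
exists (2 * (2 * K) `^ b^-1); first by rewrite mulr_gt0 ?powR_gt0 ?mulr_gt0.
move=> s t s01 t01; have /andP[s0 s1] := s01; have /andP[t0 t1] := t01.
have st01 : 0 < s * t <= 1 by rewrite mulr_gt0//= mulr_ile1// ltW.
have [k [/andP[k1 k2] /andP[k3 k4]]] := dyadic_level s01.
have [l [/andP[l1 l2] /andP[l3 l4]]] := dyadic_level st01.
have kl : (k <= l)%N.
  have : 2 ^- l.+1 < 2 ^- k :> R.
    apply: lt_le_trans l1 (le_trans _ k2).
    by apply: orlicz_fun_le; [rewrite mulr_ge0// ltW|rewrite ler_piMr// ltW].
  rewrite ltf_pV2 ?posrE ?exprn_gt0// ltr_eXn2l ?ltr1n//.
have [gk0 _ _] := orlicz_inv_dyadic k; have [gl0 _ _] := orlicz_inv_dyadic l.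
have P0 : 0 < 2 `^ (b * (l - k)%:R) by rewrite powR_gt0.
have tge : 2 `^ (- b * (l - k)%:R) <= 2 * K * t.
  rewrite mulNr powRN -[leLHS]mul1r ler_pdivrMr//.
  have := gK k (l - k)%N; rewrite subnKC// ler_pdivrMr// => h.
  rewrite -(ler_pM2l gk0) mulr1; apply: (le_trans h).
  apply: (@le_trans _ _ (K * 2 `^ (b * (l - k)%:R) * (2 * (s * t)))).
    by rewrite ler_pM2l ?mulr_gt0//; lra.
  set X := 2 `^ _ in P0 *.
  have : 0 <= (g k - s) * (X * K * t) by rewrite mulr_ge0 ?subr_ge0// ?mulr_ge0 ?ltW.
  lra.
have {}tge : 2 ^- (l - k) <= (2 * K) `^ b^-1 * t `^ b^-1.
  rewrite -powRM ?mulr_ge0 ?(ltW K0) ?(ltW t0)//.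
  have -> : 2 ^- (l - k) = (2 `^ (- b * (l - k)%:R)) `^ b^-1 :> R.
    by rewrite -powRrM mulrAC mulNr divff ?gt_eqF// mulN1r powR_invn.
  by apply: ge0_ler_powR => //; rewrite ?nnegrE ?invr_ge0 ?mulr_ge0 ?powR_ge0 ?(ltW b0) ?(ltW K0)// ltW.
apply: (le_trans l2).
have -> : 2 ^- l = 2 ^- k * 2 ^- (l - k) :> R by rewrite -invfM -exprD subnKC.
have -> : 2 * (2 * K) `^ b^-1 * (N s * t `^ b^-1) =
    (2 * N s) * ((2 * K) `^ b^-1 * t `^ b^-1) by ring.
apply: ler_pM => //; rewrite ?invr_ge0 ?exprn_ge0//.
by rewrite -ler_pdivrMl// -invfM -exprS ltW.
Qed.

(** This is the Delta_2 condition at zero. With M' = M + 1, either M' y <= 1 and the minorant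
    applies to M' y and 1 / M', or y > 1 / M' and N y is bounded below by N (1 / M'). *)
Lemma pow_minorant_dilation r M : pow_minorant r -> 0 <= M ->
  exists2 K : R, 0 < K & forall y, 0 <= y <= 1 -> N (M * y) <= K * N y.
Proof.
move=> [c c0 Nr] M0; pose M' := M + 1; have M'1 : 1 <= M' by rewrite /M'; lra.
have M'0 : 0 < M' by lra.
have MM y : 0 <= y -> N (M * y) <= N (M' * y).
  by move=> y0; apply: orlicz_fun_le; rewrite ?mulr_ge0// ler_wpM2r// /M'; lra.
have v0 : 0 < M'^-1 <= 1 by rewrite invr_gt0 M'0 invf_le1.
pose K1 := (c * M'^-1 `^ r)^-1; pose K2 := N M' / N M'^-1.
have K10 : 0 < K1 by rewrite invr_gt0 mulr_gt0// powR_gt0; case/andP: v0.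
have K20 : 0 < K2 by rewrite divr_gt0 ?orlicz_fun_gt0//; case/andP: v0.
exists (K1 + K2) => [|y /andP[y0 y1]]; first by rewrite addr_gt0.
apply: (le_trans (MM _ y0)).
move: y0; rewrite le_eqVlt => /predU1P[<-|y0]; first by rewrite mulr0 orlicz_fun0 mulr0.
have Ny0 := orlicz_fun_gt0 y0.
have [My|My] := leP (M' * y) 1.
  have := Nr (M' * y) M'^-1; rewrite mulr_gt0// My => /(_ isT v0).
  rewrite mulrAC divff ?gt_eqF// mul1r => h.
  apply: (@le_trans _ _ (K1 * N y)); last by rewrite ler_pM2r//; lra.
  rewrite ler_pdivlMl; first by rewrite -mulrA [X in _ * X]mulrC.
  by rewrite mulr_gt0// powR_gt0; case/andP: v0.
apply: (@le_trans _ _ (K2 * N y)); last by rewrite ler_pM2r//; lra.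
rewrite /K2 mulrAC ler_pdivlMr ?orlicz_fun_gt0//; last by case/andP: v0.
apply: ler_pM; rewrite ?orlicz_fun_ge0 ?mulr_ge0 ?(ltW M'0) ?(ltW y0)//.
- by case/andP: v0 => /ltW.
- by rewrite orlicz_fun_le ?mulr_ge0 ?(ltW M'0) ?(ltW y0)// ger_pMr.
- rewrite orlicz_fun_le//; first by case/andP: v0 => /ltW.
  by rewrite -[leLHS]mulr1 ler_pdivrMl// ltW.
Qed.

End OrliczFunction.

(** * Power growth along geometric grids *)

Section PowerApproximation.
Variables (R : realType) (N : R -> R) (r : R).
Hypotheses (NO : orlicz_fun N) (N1 : N 1 = 1) (Nr : pow_minorant N r).
Implicit Types (s t th q p A e : R).

Lemma expr_itv th k : 0 < th < 1 -> 0 < th ^+ k <= 1.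
Proof. by move=> /andP[t0 t1]; rewrite exprn_gt0//= exprn_ile1// ltW. Qed.

Lemma expr_decr th m k : 0 < th < 1 -> (m <= k)%N -> th ^+ k <= th ^+ m.
Proof. by move=> /andP[t0 t1] mk; apply: ler_wiXn2l => //; exact: ltW. Qed.

Lemma expr_powRC th q k : 0 <= th -> (th ^+ k) `^ q = (th `^ q) ^+ k.
Proof. by move=> t0; rewrite -powR_mulrn// powRAC powR_mulrn// powR_ge0. Qed.

Lemma powR_log th x : 0 < th < 1 -> 0 < x -> th `^ (ln x / ln th) = x.
Proof.
move=> /andP[t0 t1] x0; rewrite /powR gt_eqF//.
have l0 : ln th < 0 by rewrite ln_lt0// t0.
by rewrite divfK ?lt_eqF// lnK.
Qed.

(** Shifting by finitely many grid steps costs a constant, which lets the next two lemmas assume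
    growth only from some index b0 on. *)
Lemma orlicz_fun_grid_shift th m : 0 < th < 1 ->
  exists2 K : R, 0 < K & forall k, N (th ^+ k) <= K * N (th ^+ (k + m)).
Proof.
move=> th01; have /andP[h0 h1] := expr_itv m th01.
have [|K K0 NK] := pow_minorant_dilation NO Nr (M := (th ^+ m)^-1).
  by rewrite invr_ge0 ltW.
exists K => // k; have := NK (th ^+ (k + m)).
have /andP[a0 a1] := expr_itv (k + m) th01; rewrite (ltW a0) a1 => /(_ isT).
by rewrite exprD mulrC mulfK ?gt_eqF.
Qed.

(** Round s and t to the grid with indices k and l. Then s t lies above th^(k + l + 2), and the grid
    shift moves k past b0; the two extra steps account for the square of th^q in the constant. *)
Lemma grid_pow_minorant th q c b0 : 0 < th < 1 -> 0 < q -> 0 < c ->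
  (forall b i, (b0 <= b)%N -> c * (th `^ q) ^+ i * N (th ^+ b) <= N (th ^+ (b + i))) ->
  pow_minorant N q.
Proof.
move=> th01 q0 c0 cN; have [K K0 NK] := orlicz_fun_grid_shift b0 th01.
have th0 : 0 < th by case/andP: th01.
have tq0 : 0 < th `^ q by rewrite powR_gt0.
exists (c * (th `^ q) ^+ 2 / K); first by rewrite divr_gt0// mulr_gt0// exprn_gt0.
move=> s t s01 t01; have /andP[s0 s1] := s01; have /andP[t0 t1] := t01.
have [k /andP[k1 k2]] := exists_expr_bracket th01 s01.
have [l /andP[l1 l2]] := exists_expr_bracket th01 t01.
have ge0 n : 0 <= th ^+ n by rewrite exprn_ge0// ltW.
have : N (th ^+ (k + b0 + (l + 2))) <= N (s * t).
  apply: orlicz_fun_le => //; apply: (@le_trans _ _ (th ^+ k.+1 * th ^+ l.+1)).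
    rewrite -exprD; apply: expr_decr => //.
    by rewrite addSn !addnS !addn0 !ltnS leq_add2r leq_addr.
  by apply: ler_pM => //; exact: ltW.
apply: le_trans; apply: le_trans (cN _ _ _); last by rewrite leq_addl.
have tq : t `^ q <= (th `^ q) ^+ l.
  by rewrite -expr_powRC ?(ltW th0)// ge0_ler_powR ?nnegrE ?(ltW t0) ?(ltW q0).
have Ns : N s / K <= N (th ^+ (k + b0)).
  rewrite ler_pdivrMr// mulrC; apply: le_trans (NK k).
  by apply: orlicz_fun_le => //; exact: ltW.
have -> : c * th `^ q ^+ 2 / K * (N s * t `^ q) = c * (th `^ q ^+ 2 * t `^ q) * (N s / K).
  by field; rewrite gt_eqF.
have Ns0 : 0 <= N s by rewrite orlicz_fun_ge0// ltW.
apply: ler_pM => //.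
- by rewrite !mulr_ge0 ?exprn_ge0 ?powR_ge0// ltW.
- by rewrite divr_ge0// ltW.
by rewrite ler_pM2l// addnC exprD ler_pM2l ?exprn_gt0.
Qed.

Lemma grid_pow_majorant th q c b0 : 0 < th < 1 -> 0 < q -> 0 < c ->
  (forall b i, (b0 <= b)%N -> N (th ^+ (b + i)) <= c * (th `^ q) ^+ i * N (th ^+ b)) ->
  pow_majorant N q.
Proof.
(* One step more than b0, because s is bounded below only by th^(k + 1). *)
move=> th01 q0 c0 cN; have [K K0 NK] := orlicz_fun_grid_shift b0.+1 th01.
have th0 : 0 < th by case/andP: th01.
have tq0 : 0 < th `^ q by rewrite powR_gt0.
exists (K * c / th `^ q); first by rewrite divr_gt0// mulr_gt0// exprn_gt0.
move=> s t s01 t01; have /andP[s0 s1] := s01; have /andP[t0 t1] := t01.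
have [k /andP[k1 k2]] := exists_expr_bracket th01 s01.
have [l /andP[l1 l2]] := exists_expr_bracket th01 t01.
have ge0 n : 0 <= th ^+ n by rewrite exprn_ge0// ltW.
have : N (s * t) <= N (th ^+ (k + l)).
  apply: orlicz_fun_le => //; first by rewrite mulr_ge0// ltW.
  by rewrite exprD; apply: ler_pM => //; exact: ltW.
move=> /le_trans; apply; apply: (le_trans (NK _)).
have -> : (k + l + b0.+1 = k + b0.+1 + l)%N by rewrite addnAC.
have h1 : N (th ^+ (k + b0.+1 + l)) <= c * (th `^ q) ^+ l * N (th ^+ (k + b0.+1))
  by apply: cN; rewrite addnS leqW// leq_addl.
have h2 : N (th ^+ (k + b0.+1)) <= N s.
  apply: orlicz_fun_le => //; apply: le_trans (ltW k1).
  by apply: expr_decr => //; rewrite addnS ltnS leq_addr.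
have tq : (th `^ q) ^+ l <= t `^ q / th `^ q.
  rewrite ler_pdivlMr// -exprSr -expr_powRC ?(ltW th0)//.
  by rewrite ge0_ler_powR ?nnegrE ?(ltW t0) ?(ltW q0)// ltW.
have -> : K * c / th `^ q * (N s * t `^ q) = K * (c * (t `^ q / th `^ q) * N s).
  by field; rewrite gt_eqF.
rewrite ler_pM2l//; apply: (le_trans h1); apply: ler_pM => //.
- by rewrite !mulr_ge0 ?exprn_ge0 ?powR_ge0// ltW.
- exact: orlicz_fun_ge0.
by rewrite ler_pM2l.
Qed.

(** If no such interval existed, [endpoint_dichotomy] would make h grow or decay geometrically.
    Since h is N along the grid divided by the p-th power, growth gives a minorizing power below p
    and decay a majorizing power above p. *)
Lemma exists_flat_interval th p eta J : 0 < th < 1 -> 0 < p ->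
  (forall q, 0 < q < p -> ~ pow_minorant N q) ->
  (forall q, p < q -> ~ pow_majorant N q) -> 0 < eta <= 1 ->
  let h j := N (th ^+ j) / (th `^ p) ^+ j in
  exists a b, (J <= a < b)%N /\ h a + h b <= eta * \sum_(a <= j < b) h j.
Proof.
move=> th01 p0 nmin nmaj e01 h; apply: contrapT => nex.
have th0 : 0 < th by case/andP: th01.
have tp0 : 0 < th `^ p by rewrite powR_gt0.
have lth : ln th < 0 by rewrite ln_lt0.
have hj0 j : 0 < h j by rewrite divr_gt0 ?exprn_gt0// orlicz_fun_gt0// exprn_gt0.
have hN (x c : R) i b : (c * x ^+ i * h b <= h (b + i)%N) =
    (c * (th `^ p * x) ^+ i * N (th ^+ b) <= N (th ^+ (b + i))).
  rewrite /h ler_pdivlMr ?exprn_gt0//; congr (_ <= _).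
  by rewrite exprMn exprD; field; rewrite expf_neq0// gt_eqF.
have hN' (x c : R) i b : (h (b + i)%N <= c * x ^+ i * h b) =
    (N (th ^+ (b + i)) <= c * (th `^ p * x) ^+ i * N (th ^+ b)).
  rewrite /h ler_pdivrMr ?exprn_gt0//; congr (_ <= _).
  by rewrite exprMn exprD; field; rewrite expf_neq0// gt_eqF.
have [|b0 [d [c [/andP[d0 d1] [c0 [grow|decay]]]]]] := @endpoint_dichotomy _ h eta J hj0 e01.
- move=> a b Jab; rewrite ltNge; apply/negP => ?; apply: nex.
  by exists a, b.
(* The exponent ln (1 + d) / ln th is negative and turns the factor 1 + d into a power of th; the
   maximum with p / 2 keeps q positive. *)
- pose q := Num.max (p + ln (1 + d) / ln th) (p / 2).
  have l1 : ln (1 + d) / ln th < 0.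
    by rewrite pmulr_rlt0 ?invr_lt0// ln_gt0//; lra.
  apply: (nmin q).
    by rewrite /q lt_max gt_max; apply/andP; split; [apply/orP; right|apply/andP; split]; lra.
  apply: (@grid_pow_minorant th q c b0) => //.
    by rewrite /q lt_max; apply/orP; right; lra.
  move=> b i bb; have := grow _ i bb; rewrite hN; apply: le_trans.
  have Nb0 : 0 < N (th ^+ b) by rewrite orlicz_fun_gt0// exprn_gt0.
  rewrite (ler_pM2r Nb0) (ler_pM2l c0).
  apply: lerXn2r; rewrite ?nnegrE ?mulr_ge0 ?powR_ge0 ?(ltW tp0)//; first by lra.
  rewrite -(@powR_log th (1 + d)) //; last by lra.
  rewrite -powRD; last by rewrite (gt_eqF th0) implybT.
  by apply: ger_powR; [case/andP: th01 => -> /ltW|rewrite /q le_max lexx].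
- pose q := p + ln (1 - d) / ln th.
  have l1 : 0 < ln (1 - d) / ln th.
    by rewrite nmulr_rgt0 ?invr_lt0// ln_lt0//; lra.
  apply: (nmaj q); first by rewrite /q; lra.
  apply: (@grid_pow_majorant th q c b0) => //; first by rewrite /q; lra.
  move=> b i bb; have := decay _ i bb; rewrite hN'.
  by rewrite /q powRD ?(gt_eqF th0) ?implybT// powR_log//; lra.
Qed.

End PowerApproximation.

(** * Approximation of powers by modulars *)

Section Quantization.
Variable R : realType.

(** Bounds the boundary windows that appear when an interval is shifted by at most L steps: within
    them h exceeds its first value by at most M^L. *)
Lemma sum_shift_le (h : nat -> R) (M : R) a i L : (forall j, 0 <= h j) -> 1 <= M ->
  (forall j, h j.+1 <= M * h j) -> (i <= L)%N ->
  \sum_(a <= j < a + i) h j <= L%:R * M ^+ L * h a.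
Proof.
move=> h0 M1 hM iL; have M0 : 0 <= M by apply: le_trans M1.
have hk k : h (a + k)%N <= M ^+ k * h a.
  elim: k => [|k IH]; first by rewrite addn0 expr0 mul1r.
  by rewrite addnS (le_trans (hM _))// exprS -mulrA ler_wpM2l.
have Lha : 0 <= M ^+ L * h a by rewrite mulr_ge0// exprn_ge0.
apply: (@le_trans _ _ (i%:R * (M ^+ L * h a))); last first.
  by rewrite -mulrA ler_wpM2r// ler_nat.
rewrite -{1}[a]add0n big_addn addKn mulr_natl -[X in _ *+ X]subn0 -sumr_const_nat.
apply: ler_sum_nat => k /andP[_ ki]; rewrite addnC (le_trans (hk k))// ler_wpM2r//.
by apply: ler_weXn2l => //; exact: leq_trans (ltnW ki) iL.
Qed.

(** Shifting the interval changes the sum only near its two ends; this is what makes the combination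
    on a flat interval almost homogeneous. *)
Lemma sum_translate (h : nat -> R) a b i : (a <= b)%N ->
  \sum_(a <= j < b) h (j + i)%N - \sum_(a <= j < b) h j =
  \sum_(b <= j < b + i) h j - \sum_(a <= j < a + i) h j.
Proof.
move=> ab.
have -> : \sum_(a <= j < b) h (j + i)%N = \sum_(a + i <= j < b + i) h j.
  by rewrite big_addn addnK.
have e1 : \sum_(a <= j < b + i) h j = \sum_(a <= j < b) h j + \sum_(b <= j < b + i) h j.
  by rewrite (big_cat_nat ab) ?leq_addr.
have e2 : \sum_(a <= j < b + i) h j =
    \sum_(a <= j < a + i) h j + \sum_(a + i <= j < b + i) h j.
  by rewrite (big_cat_nat (leq_addr i a)) ?leq_add2r.
lra.
Qed.

Lemma geometric_sum_le (th : R) a b : 0 < th < 1 ->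
  \sum_(a <= j < b) th ^+ j <= th ^+ a / (1 - th).
Proof.
move=> /andP[t0 t1]; have t10 : 0 < 1 - th by rewrite subr_gt0.
rewrite ler_pdivlMr//.
have [ab|ba] := leqP a b; last first.
  by rewrite big_geq ?(ltnW ba)// mul0r exprn_ge0 ?(ltW t0).
suff -> : (\sum_(a <= j < b) th ^+ j) * (1 - th) = th ^+ a - th ^+ b.
  by rewrite gerBl exprn_ge0 ?(ltW t0).
elim: b ab => [|b IH]; first by rewrite leqn0 => /eqP ->; rewrite big_geq// subrr mul0r.
rewrite leq_eqVlt => /predU1P[->|]; first by rewrite big_geq// subrr mul0r.
by rewrite ltnS => ab; rewrite big_nat_recr//= mulrDl IH// exprS; ring.
Qed.

Variables (N : R -> R) (r : R).
Hypotheses (NO : orlicz_fun N) (N1 : N 1 = 1) (Nr : pow_minorant N r).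
Implicit Types (t p A e : R).

Lemma grid_pow_approx p th A e L : 0 < p -> 0 < th < 1 -> 0 < A -> 0 < e ->
  (forall q, 0 < q < p -> ~ pow_minorant N q) ->
  (forall q, p < q -> ~ pow_majorant N q) ->
  exists xs : seq R, all (>= 0) xs /\
    forall i, (i <= L)%N ->
      `|\sum_(x <- xs) N (th ^+ i * x) - A * (th `^ p) ^+ i| <= e.
Proof.
move=> p0 th01 A0 e0 nmin nmaj.
have /andP[th0 th1] := th01.
pose tau := th `^ p; have tau0 : 0 < tau by rewrite powR_gt0.
have tau1 : tau <= 1.
  have := @ge0_ler_powR _ p (ltW p0) th 1.
  by rewrite powR1 !nnegrE (ltW th0) ler01 (ltW th1) => /(_ isT isT isT).
pose M := tau^-1; have M1 : 1 <= M by rewrite invf_ge1.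
have M0 : 0 < M by rewrite invr_gt0.
pose B := L%:R * M ^+ L; have B0 : 0 <= B by rewrite mulr_ge0// exprn_ge0// ltW.
(* Chosen so that the boundary error, at most A * B * eta, stays below e / 2; the added 1 covers B =
   0, that is L = 0. *)
pose eta := Num.min 1 (e / 2 / (A * B + 1)).
have AB0 : 0 < A * B + 1 by rewrite ltr_wpDl// mulr_ge0// ltW.
have eta01 : 0 < eta <= 1.
  by rewrite /eta lt_min ge_min lexx ltr01/= andbT; do 2 rewrite divr_gt0//.
(* Starting the interval beyond J bounds the total rounding error by th^J / (1 - th) < e / 2. *)
have [J thJ] : exists J, th ^+ J < e / 2 * (1 - th).
  apply: exists_expr_lt; first by rewrite (ltW th0).
  by rewrite mulr_gt0 ?divr_gt0// subr_gt0.
have [a [b [/andP[Ja ab]]]] := exists_flat_interval NO Nr J th01 p0 nmin nmaj eta01.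
rewrite -/tau; pose h j := N (th ^+ j) / tau ^+ j.
rewrite -!/(h _); set S := \sum_(a <= j < b) _ => hab.
have thn0 n : 0 < th ^+ n by rewrite exprn_gt0.
have taun0 n : 0 < tau ^+ n by rewrite exprn_gt0.
have h0 j : 0 < h j by rewrite divr_gt0// orlicz_fun_gt0.
have S0 : 0 < S.
  rewrite /S big_ltn//; apply: ltr_wpDr; last exact: h0.
  by apply: sumr_ge0 => j _; exact: (ltW (h0 j)).
have hM j : h j.+1 <= M * h j.
  rewrite /h [tau ^+ _.+1]exprS invfM mulrCA -/M ler_pM2l// ler_pM2r ?invr_gt0//.
  by apply: orlicz_fun_le => //; [exact: ltW|rewrite exprS ler_piMl// ltW].
(* With these real multiplicities the modular at th^i is A tau^i / S times the sum of h over the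
   interval shifted by i, hence close to A tau^i. *)
pose w j := A / S / tau ^+ j; have w0 j : 0 <= w j by rewrite !divr_ge0 ?ltW.
(* The block must repeat th^j an integral number of times. *)
pose n j := Num.trunc (w j).
exists (flatten [seq nseq (n j) (th ^+ j) | j <- index_iota a b]); split.
  apply/allP => x /flattenP[ys /mapP[j _ ->]].
  by rewrite mem_nseq => /andP[_ /eqP ->]; exact: ltW.
move=> i iL; rewrite big_flatten big_map.
under eq_bigr do rewrite big_nseq iter_addr_0 -mulr_natl -exprD.
have -> : \sum_(a <= j < b) (n j)%:R * N (th ^+ (i + j)) - A * tau ^+ i =
   (\sum_(a <= j < b) w j * N (th ^+ (i + j)) - A * tau ^+ i)
   - \sum_(a <= j < b) (w j - (n j)%:R) * N (th ^+ (i + j)).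
  under [X in _ = _ - X]eq_bigr do rewrite mulrBl.
  rewrite sumrB; ring.
have N0 k : 0 <= N (th ^+ k) by rewrite orlicz_fun_ge0// ltW.
have wn j : 0 <= w j - (n j)%:R <= 1.
  have /andP[h1 h2] := truncn_itv (w0 j).
  by rewrite subr_ge0 h1 lerBlDl -natr1 in h2 *; exact: ltW.
have err0 : 0 <= \sum_(a <= j < b) (w j - (n j)%:R) * N (th ^+ (i + j)).
  by apply: sumr_ge0 => j _; rewrite mulr_ge0//; case/andP: (wn j).
have err : \sum_(a <= j < b) (w j - (n j)%:R) * N (th ^+ (i + j)) <= e / 2.
  apply: (@le_trans _ _ (\sum_(a <= j < b) th ^+ j)).
    apply: ler_sum => j _; rewrite -[leRHS]mul1r; have /andP[? ?] := wn j.
    apply: ler_pM => //; apply: (@le_trans _ _ (th ^+ (i + j))).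
      by apply: orlicz_fun_le_id => //; rewrite (ltW (thn0 _)) exprn_ile1 ?ltW.
    by apply: expr_decr => //; rewrite leq_addl.
  apply: (le_trans (geometric_sum_le _ _ th01)); rewrite ler_pdivrMr ?subr_gt0//.
  by apply: le_trans (ltW thJ); exact: expr_decr.
have main : `|\sum_(a <= j < b) w j * N (th ^+ (i + j)) - A * tau ^+ i| <= e / 2.
  have -> : \sum_(a <= j < b) w j * N (th ^+ (i + j)) =
      A * tau ^+ i / S * \sum_(a <= j < b) h (j + i)%N.
    rewrite mulr_sumr; apply: eq_bigr => j _; rewrite /w /h [(i + j)%N]addnC [tau ^+ (_ + _)]exprD.
    by field; rewrite gt_eqF//= !expf_neq0// gt_eqF.
  have -> : A * tau ^+ i / S * (\sum_(a <= j < b) h (j + i)%N) - A * tau ^+ i =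
      A * tau ^+ i / S * (\sum_(a <= j < b) h (j + i)%N - S).
    by field; rewrite gt_eqF.
  rewrite sum_translate ?(ltnW ab)//.
  have h0' j : 0 <= h j by exact: ltW.
  have ta := sum_shift_le a h0' M1 hM iL; have tb := sum_shift_le b h0' M1 hM iL.
  have sa : 0 <= \sum_(a <= j < a + i) h j by apply: sumr_ge0.
  have sb : 0 <= \sum_(b <= j < b + i) h j by apply: sumr_ge0.
  have C0 : 0 <= A * tau ^+ i / S by rewrite divr_ge0 ?mulr_ge0 ?ltW.
  have CA : A * tau ^+ i / S <= A / S.
    by rewrite ler_pM2r ?invr_gt0// ger_pMr// exprn_ile1// ltW.
  rewrite normrM (ger0_norm C0).
  apply: (@le_trans _ _ (A / S * (B * (h a + h b)))).
    apply: ler_pM => //; rewrite -/B in ta tb; rewrite ler_norml; lra.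
  apply: (@le_trans _ _ (A / S * (B * (eta * S)))).
    by apply: ler_wpM2l; [rewrite divr_ge0 ?ltW|exact: ler_wpM2l].
  have -> : A / S * (B * (eta * S)) = A * B * eta by field; rewrite gt_eqF.
  apply: (@le_trans _ _ (A * B * (e / 2 / (A * B + 1)))).
    by apply: ler_wpM2l; [rewrite mulr_ge0// ltW|rewrite /eta ge_min lexx orbT].
  rewrite mulrA ler_pdivrMr// mulrC ler_wpM2l ?divr_ge0 ?(ltW e0)//; lra.
apply: (le_trans (ler_normB _ _)); rewrite (ger0_norm err0); lra.
Qed.

Lemma pow_approx p A e : 0 < p -> 0 < A -> 0 < e ->
  (forall q, 0 < q < p -> ~ pow_minorant N q) ->
  (forall q, p < q -> ~ pow_majorant N q) ->
  exists xs : seq R, all (>= 0) xs /\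
    forall t, 0 <= t <= 1 -> `|\sum_(x <- xs) N (t * x) - A * t `^ p| <= e.
Proof.
move=> p0 A0 e0 nmin nmaj.
(* The grid is fine enough for A t^p to vary by at most e / 2 within one cell. *)
pose tau := A / (A + e / 2).
have Ae : 0 < A + e / 2 by lra.
have tau0 : 0 < tau by rewrite divr_gt0.
have tau1 : tau < 1 by rewrite ltr_pdivrMr// mul1r; lra.
have Atau : A * (1 - tau) <= e / 2.
  have -> : A * (1 - tau) = (e / 2) * tau.
    by rewrite /tau; field; apply: lt0r_neq0; lra.
  by apply: ler_piMr; [lra|exact: ltW].
pose th := tau `^ p^-1.
have th0 : 0 < th by rewrite powR_gt0.
have th1 : th < 1.
  have := @gt0_ltr_powR _ p^-1 _ tau 1; rewrite powR1; apply=> //.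
  - by rewrite invr_gt0.
  - by rewrite nnegrE ltW.
  - by rewrite nnegrE.
have th01 : 0 < th < 1 by rewrite th0.
have thp : th `^ p = tau by rewrite -powRrM mulVf ?gt_eqF// powRr1// ltW.
have [L tauL] : exists L, tau ^+ L < e / 4 / A.
  by apply: exists_expr_lt; rewrite ?(ltW tau0)// !divr_gt0.
have e40 : 0 < e / 4 by lra.
have [xs [xs0 xsL]] := grid_pow_approx L p0 th01 A0 e40 nmin nmaj.
exists xs; split=> // t /andP[t0 t1].
pose G u := \sum_(x <- xs) N (u * x).
have Gle u v : 0 <= u -> u <= v -> G u <= G v.
  move=> u0 uv; rewrite /G !big_seq; apply: ler_sum => x /(allP xs0)/= x0.
  by apply: orlicz_fun_le => //; rewrite ?mulr_ge0// ler_wpM2r.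
have G0 : G 0 = 0 by rewrite /G big1// => x _; rewrite mul0r orlicz_fun0.
have thn0 n : 0 <= th ^+ n by rewrite exprn_ge0// ltW.
have Gt u : 0 <= u -> 0 <= G u by move=> u0; rewrite -G0; exact: Gle.
have AtL : A * tau ^+ L <= e / 4.
  by have := ltW tauL; rewrite ler_pdivlMr// mulrC.
(* Beyond L both quantities are at most e / 2 by monotonicity, so control at finitely many grid
   points suffices. *)
have Gi i : `|G (th ^+ i) - A * tau ^+ i| <= e / 2.
  have [iL|Li] := leqP i L; first by have := xsL _ iL; rewrite thp -/(G _); lra.
  have h1 := xsL _ (leqnn L); rewrite thp -/(G _) ler_norml in h1.
  have h2 : G (th ^+ i) <= G (th ^+ L) by apply: Gle => //; apply: expr_decr => //; exact: ltnW.
  have h3 : A * tau ^+ i <= A * tau ^+ L.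
    by rewrite ler_pM2l//; apply: expr_decr; rewrite ?tau0//; exact: ltnW.
  have h4 : 0 <= A * tau ^+ i by rewrite mulr_ge0 ?exprn_ge0 ?ltW.
  have h5 := Gt _ (thn0 i).
  rewrite ler_norml; case/andP: h1 => h1 h1'; lra.
rewrite -/(G t).
move: t0; rewrite le_eqVlt => /predU1P[<-|t0].
  by rewrite G0 powR0 ?gt_eqF// mulr0 subrr normr0 ltW.
have [i /andP[i1 i2]] : exists i, th ^+ i.+1 < t <= th ^+ i.
  by apply: exists_expr_bracket; rewrite ?t0.
have p1 : tau ^+ i.+1 <= t `^ p.
  by rewrite -thp -expr_powRC ?(ltW th0)// ge0_ler_powR ?nnegrE ?(ltW p0) ?(ltW t0) ?(ltW i1).
have p2 : t `^ p <= tau ^+ i.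
  by rewrite -thp -expr_powRC ?(ltW th0)// ge0_ler_powR ?nnegrE ?(ltW p0) ?(ltW t0).
have g1 : G (th ^+ i.+1) <= G t by apply: Gle => //; exact: ltW.
have g2 : G t <= G (th ^+ i) by apply: Gle => //; exact: ltW.
have dt : A * tau ^+ i - A * tau ^+ i.+1 <= e / 2.
  have -> : A * tau ^+ i - A * tau ^+ i.+1 = tau ^+ i * (A * (1 - tau)) by rewrite exprS; ring.
  apply: (le_trans _ Atau); apply: ler_piMl; first by rewrite mulr_ge0 ?subr_ge0 ?ltW.
  by rewrite exprn_ile1// ltW.
have := Gi i; have := Gi i.+1; rewrite !ler_norml => /andP[a1 a2] /andP[b1 b2].
have q1 : A * tau ^+ i.+1 <= A * t `^ p by rewrite ler_pM2l.
have q2 : A * t `^ p <= A * tau ^+ i by rewrite ler_pM2l.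
lra.
Qed.

End Quantization.

(** * Modulars and norms *)

Section Modular.
Variables (R : realType) (N : R -> R).
Hypothesis NO : orlicz_fun N.
Implicit Types (x y : nat -> R) (a u v C : R).

Lemma orlicz_term_ge0 x u k : 0 < u -> (0 <= (N (`|x k| / u))%:E)%E.
Proof. by move=> u0; rewrite lee_fin orlicz_fun_ge0// divr_ge0// ltW. Qed.

Lemma orlicz_modular_term x u k : 0 < u -> (orlicz_modular N x u <= 1)%E ->
  N (`|x k| / u) <= 1.
Proof.
move=> u0 xu; rewrite -lee_fin (le_trans _ xu)//.
have := @nneseries_lim_ge _ (fun k => (N (`|x k| / u))%:E) xpredT 0 k.+1
  (fun k _ _ => orlicz_term_ge0 x k u0).
apply: le_trans; rewrite big_nat_recr//= leeDr// sume_ge0// => i _.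
exact: orlicz_term_ge0.
Qed.

Lemma le_orlicz_modular x u v : 0 < u -> u <= v ->
  (orlicz_modular N x v <= orlicz_modular N x u)%E.
Proof.
move=> u0 uv; have v0 : 0 < v by exact: lt_le_trans uv.
apply: lee_nneseries => [k _ _|k _]; first exact: orlicz_term_ge0.
rewrite lee_fin orlicz_fun_le//; first by rewrite divr_ge0// ltW.
by rewrite ler_wpM2l// lef_pV2.
Qed.

Lemma orlicz_modular_compare x u v C : 0 < u -> 0 < v -> 0 <= C ->
  (forall k, N (`|x k| / u) <= C * N (`|x k| / v)) ->
  (orlicz_modular N x u <= C%:E * orlicz_modular N x v)%E.
Proof.
move=> u0 v0 C0 h; rewrite /orlicz_modular -nneseriesZl; last first.
  by move=> k _; exact: orlicz_term_ge0.
apply: lee_nneseries => [k _ _|k _]; first exact: orlicz_term_ge0.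
by rewrite -EFinM lee_fin.
Qed.

(** Nonnegative terms allow reading the series as an unordered sum, which a bijection of the indices
    preserves. *)
Lemma orlicz_modular_odist x y u : 0 < u -> same_odist x y ->
  orlicz_modular N x u = orlicz_modular N y u.
Proof.
move=> u0 [pi [pi_bij yx]]; rewrite /orlicz_modular.
rewrite !nneseries_esum; [|by move=> k _; exact: orlicz_term_ge0..].
have -> : [set k : nat | xpredT k] = setT by apply/seteqP.
rewrite [RHS](@reindex_esum _ _ _ setT setT pi) ?setTT_bijective//.
by apply: eq_esum => k _; rewrite yx.
Qed.

Lemma orlicz_modular_finite x u B : 0 < u -> (forall k, (B <= k)%N -> x k = 0) ->
  orlicz_modular N x u = (\sum_(0 <= k < B) N (`|x k| / u))%:E.
Proof.
move=> u0 xB; rewrite /orlicz_modular (@nneseries_split _ _ 0 B); last first.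
  by move=> k _; exact: orlicz_term_ge0.
rewrite add0n eseries0 ?adde0 ?sumEFin// => k Bk _.
by rewrite xB// normr0 mul0r orlicz_fun0.
Qed.

Lemma orlicz_modular_block alpha a b e u : 0 < u -> (b <= e)%N ->
  orlicz_modular N (fun i => a * block alpha b e i) u =
  (\sum_(b <= i < e) N (`|a * alpha i| / u))%:E.
Proof.
move=> u0 be; rewrite (@orlicz_modular_finite _ _ e)//; last first.
  by move=> k ek; rewrite /block [(k < e)%N]ltnNge ek andbF mulr0.
congr (_%:E); rewrite (big_cat_nat (leq0n b) be)/= big_nat big1 ?add0r.
  by apply: eq_big_nat => i bie; rewrite /block bie.
move=> i /andP[_ ib]; rewrite /block [(b <= i)%N]leqNgt ib/=.
by rewrite mulr0 normr0 mul0r orlicz_fun0.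
Qed.

(** At each index at most one vector is nonzero, and N 0 = 0, so N of the combination is the sum of
    the individual terms. *)
Lemma orlicz_modular_lincomb n (c : 'I_n -> R) (X : 'I_n -> nat -> R) u : 0 < u ->
  (forall j k, j != k -> forall i, X j i = 0 \/ X k i = 0) ->
  orlicz_modular N (lincomb c X) u =
  (\sum_(k < n) orlicz_modular N (fun i => (c k * X k i)%R) u)%E.
Proof.
move=> u0 disj; rewrite /orlicz_modular -nneseries_sum; last first.
  by move=> k j _; exact: (orlicz_term_ge0 (fun i => c k * X k i)).
apply: eq_eseriesr => i _; rewrite sumEFin; congr (_%:E).
have N0 k : X k i = 0 -> N (`|c k * X k i| / u) = 0.
  by move=> ->; rewrite mulr0 normr0 mul0r orlicz_fun0.
have [[k0 Xk0]|nX] := pselect (exists k, X k i != 0).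
  have X0 k : k != k0 -> X k i = 0.
    by move=> /disj/(_ i)[//|/eqP]; rewrite (negbTE Xk0).
  rewrite /lincomb (bigD1 k0)//= big1 => [|k /X0 ->]; last by rewrite mulr0.
  rewrite addr0 (bigD1 k0)//= [X in _ = _ + X]big1 ?addr0// => k /X0.
  exact: N0.
have X0 k : X k i = 0.
  by apply/eqP; apply: contrapT => /negP ?; apply: nX; exists k.
rewrite /lincomb big1 => [|k _]; last by rewrite X0 mulr0.
by rewrite normr0 mul0r orlicz_fun0// big1// => k _; exact: N0.
Qed.

Let norm_set x := [set u : R | 0 < u /\ (orlicz_modular N x u <= 1)%E].

Let norm_set_lb x : has_lbound (norm_set x).
Proof. by exists 0 => u [/ltW]. Qed.

Lemma lN_norm_ge0 x : 0 <= lN_norm N x.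
Proof.
rewrite /lN_norm -/(norm_set x); have [->|/set0P ne] := eqVneq (norm_set x) set0.
  by rewrite inf0.
by apply: lb_le_inf => // u [/ltW].
Qed.

Lemma lN_norm_le x u : 0 < u -> (orlicz_modular N x u <= 1)%E -> lN_norm N x <= u.
Proof. by move=> u0 xu; exact: (ge_inf (norm_set_lb x) (conj u0 xu)). Qed.

(* An empty set has infimum 0 here, so a positive norm shows that the infimum
   is taken over a nonempty set. *)
Lemma orlicz_modular_le1 x u : 0 < lN_norm N x -> lN_norm N x < u ->
  (orlicz_modular N x u <= 1)%E.
Proof.
move=> x0 xu; have [E|/set0P n0] := eqVneq (norm_set x) set0.
  by move: x0; rewrite /lN_norm -/(norm_set x) E inf0 ltxx.
have ux : 0 < u - lN_norm N x by rewrite subr_gt0.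
have [v [v0 xv] vu] := @inf_adherent _ (norm_set x) _ ux (conj n0 (norm_set_lb x)).
apply: le_trans xv; apply: le_orlicz_modular => //.
by move: vu; rewrite -/(lN_norm N x) addrC subrK => /ltW.
Qed.

Lemma orlicz_modular_gt1 x u : 0 < u -> u < lN_norm N x ->
  (1 < orlicz_modular N x u)%E.
Proof.
by move=> u0 ux; rewrite ltNge; apply/negP => /(lN_norm_le u0); rewrite leNgt ux.
Qed.

(** The scale v witnesses that the infimum is over a nonempty set; otherwise the norm would take the
    default value 0. *)
Lemma lN_norm_ge x u v : 0 < u -> (1 < orlicz_modular N x u)%E ->
  0 < v -> (orlicz_modular N x v <= 1)%E -> u <= lN_norm N x.
Proof.
move=> u0 xu v0 xv; apply: lb_le_inf; first by exists v.
move=> w [w0 xw]; rewrite leNgt; apply/negP => /ltW wu.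
by move: xu; rewrite ltNge (le_trans _ xw)// le_orlicz_modular.
Qed.

Lemma in_lN_finite x B : N 1 = 1 -> (forall k, (B <= k)%N -> x k = 0) -> in_lN N x.
Proof.
move=> N1 xB; pose u := 1 + \sum_(0 <= k < B) `|x k|.
have S0 : 0 <= \sum_(0 <= k < B) `|x k| by apply: sumr_ge0.
have u0 : 0 < u by rewrite /u; lra.
exists u; split=> //; rewrite (orlicz_modular_finite u0 xB) lee_fin.
apply: (@le_trans _ _ (\sum_(0 <= k < B) (`|x k| / u))); last first.
  by rewrite -mulr_suml ler_pdivrMr// mul1r /u; lra.
rewrite !big_mkord; apply: ler_sum => k _; apply: orlicz_fun_le_id => //.
rewrite divr_ge0 ?(ltW u0)//= ler_pdivrMr// mul1r /u big_mkord.
rewrite (bigD1 k)//=.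
have : 0 <= \sum_(i < B | i != k) `|x i| by apply: sumr_ge0.
lra.
Qed.

End Modular.

(** * Rearrangements of finite blocks *)

Section OrderedDistribution.
Variable R : realType.
Implicit Types x y : nat -> R.

(** The permutation of the first B indices is extended by the identity. *)
Lemma perm_eq_same_odist x y B : perm_eq (mkseq x B) (mkseq y B) ->
  (forall k, (B <= k)%N -> x k = y k) -> same_odist x y.
Proof.
move=> /(perm_iotaP 0)[Is]; rewrite size_mkseq => Isp xE xy.
have sIs : size Is = B by rewrite (perm_size Isp) size_iota.
have uIs : uniq Is by rewrite (perm_uniq Isp) iota_uniq.
have memI k : (k \in Is) = (k < B)%N by rewrite (perm_mem Isp) mem_iota.
exists (fun k => if (k < B)%N then nth 0%N Is k else k); split; last first.
  move=> k; case: ltnP => [kB|/xy//].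
  have := congr1 (nth 0 ^~ k) xE; rewrite nth_mkseq// => ->.
  rewrite (nth_map 0%N) ?sIs// nth_mkseq// -memI mem_nth ?sIs//.
exists (fun k => if (k < B)%N then index k Is else k) => k.
  rewrite /=; case: (ltnP k B) => kB; last by rewrite ltnNge kB.
  by rewrite -memI mem_nth ?sIs// index_uniq ?sIs.
rewrite /=; case: (ltnP k B) => kB; last by rewrite ltnNge kB.
by rewrite -{1}sIs index_mem memI kB nth_index ?memI.
Qed.

Lemma perm_mkseq_block (alpha : nat -> R) b e B : (b <= e <= B)%N ->
  perm_eq (mkseq (block alpha b e) B)
    (nseq (B - (e - b)) 0 ++ [seq alpha i | i <- iota b (e - b)]).
Proof.
move=> /andP[be eB]; have BE : B = (b + (e - b) + (B - e))%N by lia.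
have const0 s : {in s, forall i, block alpha b e i = 0} ->
    [seq block alpha b e i | i <- s] = nseq (size s) 0.
  move=> s0; apply: (@eq_from_nth _ 0) => [|i]; rewrite size_map ?size_nseq// => si.
  by rewrite (nth_map 0%N)// nth_nseq si s0// mem_nth.
have -> : mkseq (block alpha b e) B =
    nseq b 0 ++ [seq alpha i | i <- iota b (e - b)] ++ nseq (B - e) 0.
  rewrite /mkseq {1}BE !iotaD !map_cat add0n -catA; congr (_ ++ (_ ++ _)).
  - rewrite const0 ?size_iota// => i; rewrite mem_iota add0n => /andP[_ ib].
    by rewrite /block [(b <= i)%N]leqNgt ib.
  - apply/eq_in_map => i; rewrite mem_iota subnKC// => bie.
    by rewrite /block bie.
  - rewrite const0 ?size_iota// => i; rewrite mem_iota subnKC// => /andP[ei _].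
    by rewrite /block [(i < e)%N]ltnNge ei andbF.
have -> : (B - (e - b) = b + (B - e))%N by lia.
by rewrite perm_catCA nseqD perm_catC.
Qed.

(** Padding both blocks with zeros to a common length B turns the permutation of their entries into
    one of initial segments; equal block lengths give equally many zeros. *)
Lemma block_same_odist (alpha : nat -> R) b e b' e' : (b <= e)%N -> (b' <= e')%N ->
  (e - b = e' - b')%N ->
  perm_eq [seq alpha i | i <- iota b (e - b)] [seq alpha i | i <- iota b' (e' - b')] ->
  same_odist (block alpha b e) (block alpha b' e').
Proof.
move=> be be' eb ab; pose B := maxn e e'.
apply: (@perm_eq_same_odist _ _ B) => [|k]; last first.
  by rewrite geq_max => /andP[ek ek']; rewrite /block ![(k < _)%N]ltnNge ek ek' !andbF.
rewrite (permPl (perm_mkseq_block _ _)) ?be ?leq_maxl//.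
rewrite perm_sym (permPl (perm_mkseq_block _ _)) ?be' ?leq_maxr//.
by rewrite eb in ab *; rewrite perm_cat2l perm_sym.
Qed.

End OrderedDistribution.

(** * Growth forced by crude representability *)

Section CrudeRepresentation.
Variables (R : realType) (N : R -> R).
Hypotheses (NO : orlicz_fun N) (N1 : N 1 = 1).
Implicit Types (p : \bar R) (q C : R).

Definition reciprocal p : R := if p is q%:E then q^-1 else 0.

Lemma powR_nat_bounded q (K : R) : (forall n, n.+1%:R `^ q <= K) -> q <= 0.
Proof.
move=> H; rewrite leNgt; apply/negP => q0.
have K0 : 0 <= K by apply: le_trans (H 0%N); exact: powR_ge0.
pose n := Num.bound (K `^ q^-1).
have nK : K `^ q^-1 < n.+1%:R.
  by apply: (lt_trans (archi_boundP (powR_ge0 _ _))); rewrite ltr_nat.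
have := H n; rewrite leNgt => /negP; apply.
have -> : K = (K `^ q^-1) `^ q by rewrite -powRrM mulVf ?powRr1 ?gt_eqF.
by apply: gt0_ltr_powR; rewrite ?nnegrE ?powR_ge0 ?ler0n ?invr_gt0.
Qed.

Lemma lp_norm_ones p n : (1 <= p)%E ->
  lp_norm p (fun _ : 'I_n.+1 => 1 : R) = n.+1%:R `^ reciprocal p.
Proof.
case: p => [q _| _|//]; rewrite /lp_norm/= normr1.
  by under eq_bigr do rewrite powR1; rewrite sumr_const card_ord.
rewrite powRr0; apply/eqP; rewrite eq_le; apply/andP; split.
  by apply: bigmax_le.
by rewrite (bigD1 ord0)//= le_max lexx.
Qed.

Lemma lp_norm_delta p n : (1 <= p)%E ->
  lp_norm p (fun k : 'I_n.+1 => (k == ord0)%:R : R) = 1.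
Proof.
case: p => [q q1| _|//]; rewrite /lp_norm/=.
  have q0 : q != 0 by rewrite gt_eqF// (lt_le_trans ltr01).
  rewrite (bigD1 ord0)//= normr1 powR1 big1 ?addr0 ?powR1// => k /negbTE ->.
  by rewrite normr0 powR0.
apply/eqP; rewrite eq_le; apply/andP; split.
  by apply: bigmax_le => // k _; rewrite normr_nat lern1; case: eqP.
by rewrite (bigD1 ord0)//= normr1 le_max lexx.
Qed.

(** The equivalence is tested on the first unit vector and on the all-ones vector, whose combination
    has modular m P by disjointness and equal distribution. The factor 2 makes the norm comparisons
    strict, as the passage to modulars requires. *)
Lemma sym_vectors_modular p C n (x : 'I_n.+1 -> nat -> R) : (1 <= p)%E -> 0 < C ->
  sym_vectors N x -> lp_equiv N p C x ->
  let m : R := n.+1%:R in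
  let P u := orlicz_modular N (x ord0) u in
  let s := m `^ reciprocal p in
  [/\ (P (2 * C)%R <= 1)%E, (1 < P (2 * C)^-1%R)%E,
      (m%:E * P (2 * C * s)%R <= 1)%E & (1 < m%:E * P (s / (2 * C))%R)%E].
Proof.
move=> p1 C0 [_ disj odist] xC m P s; have m0 : 0 < m by rewrite ltr0n.
have s0 : 0 < s by rewrite powR_gt0.
have C20 : 0 < 2 * C by lra.
have iC0 : 0 < C^-1 by rewrite invr_gt0.
have Cd : C^-1 = 2 * (2 * C)^-1 by field; rewrite gt_eqF.
have iC20 : 0 < (2 * C)^-1 by rewrite invr_gt0.
have sumP u : 0 < u -> orlicz_modular N (lincomb (fun=> 1) x) u = (m%:E * P u)%E.
  move=> u0; rewrite orlicz_modular_lincomb//.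
  rewrite (eq_bigr (fun=> P u)) => [|k _].
    by rewrite sumr_const card_ord mule_natl.
  rewrite /P -(orlicz_modular_odist NO u0 (odist k ord0)).
  by congr (orlicz_modular N _ u); apply/funext => i; rewrite mul1r.
have deltaE : lincomb (fun k : 'I_n.+1 => (k == ord0)%:R) x = x ord0.
  apply/funext => i; rewrite /lincomb (bigD1 ord0)//= mul1r big1 ?addr0//.
  by move=> k /negbTE ->; rewrite mul0r.
have := xC (fun k => (k == ord0)%:R); rewrite lp_norm_delta// deltaE mulr1 mulr1.
have := xC (fun=> 1); rewrite lp_norm_ones// -/m -/s.
move=> /andP[a1 a2] /andP[b1 b2].
have a0 : 0 < lN_norm N (lincomb (fun=> 1) x) by apply: lt_le_trans a1; rewrite mulr_gt0.
have b0 : 0 < lN_norm N (x ord0) by exact: lt_le_trans b1.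
split.
- by apply: orlicz_modular_le1 => //; apply: (le_lt_trans b2); lra.
- by apply: orlicz_modular_gt1 => //; apply: lt_le_trans b1; lra.
- rewrite -sumP ?mulr_gt0//; apply: orlicz_modular_le1 => //.
  by apply: (le_lt_trans a2); rewrite ltr_pM2r//; lra.
- rewrite -sumP ?divr_gt0//; apply: orlicz_modular_gt1; rewrite ?divr_gt0//.
  by apply: lt_le_trans a1; rewrite mulrC ltr_pM2r//; lra.
Qed.

Lemma ereal_01_fin (z : \bar R) : (0 <= z)%E -> (z <= 1)%E ->
  exists2 y : R, z = y%:E & 0 <= y <= 1.
Proof.
by case: z => [y|//|//]; rewrite !lee_fin => y0 y1; exists y; rewrite ?y0.
Qed.

Lemma powR_reciprocal_ge1 p n : (1 <= p)%E -> 1 <= n.+1%:R `^ reciprocal p :> R.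
Proof.
move=> p1; rewrite -[leLHS](powRr0 n.+1%:R) ler_powR ?ler1n//.
by case: p p1 => [z /=|//|//]; rewrite lee_fin => z1; rewrite invr_ge0 (le_trans ler01).
Qed.

(** Rescaling x_1 to values in [0, 1] shows that its modular is comparable to 1 at scale 1 and to 1
    / m at scale m^(1/p), with a constant independent of n. *)
Lemma crude_modular_growth p r : (1 <= p)%E -> pow_minorant N r ->
  crude_sym_fin_rep N p ->
  exists2 K : R, 0 < K & forall n, exists (y : nat -> R) (a b : R),
    let m : R := n.+1%:R in
    [/\ forall k, 0 <= y k <= 1,
        orlicz_modular N y 1 = a%:E, orlicz_modular N y (m `^ reciprocal p) = b%:E,
        1 <= K * a <= K & 1 <= m * K * b <= K].
Proof.
move=> p1 Nr [C [C0 xC]].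
have C20 : 0 < 2 * C by lra.
have iC20 : 0 < (2 * C)^-1 by rewrite invr_gt0.
(* The scales 2 C u and u / (2 C) of the upper and lower estimates differ by the factor (2 C)^2. *)
have [|K K0 NK] := pow_minorant_dilation NO Nr (M := (2 * C) ^+ 2).
  by rewrite exprn_ge0// ltW.
exists K => // n.
have [x [xsym xeq]] := xC n.+1.
have /= [] := sym_vectors_modular p1 C0 xsym xeq.
set m : R := n.+1%:R; set t := m `^ _ => h1 h2 h3 h4.
have m0 : 0 < m by rewrite ltr0n.
have t0 : 0 < t by rewrite powR_gt0.
have t1 : 1 <= t by exact: powR_reciprocal_ge1.
pose y k := `|x ord0 k| / (2 * C).
have y01 k : 0 <= y k <= 1.
  rewrite divr_ge0 ?(ltW C20)//=; apply: (orlicz_fun_le_inv NO ler01).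
  by rewrite N1; exact: orlicz_modular_term h1.
have yE u : orlicz_modular N y u = orlicz_modular N (x ord0) (2 * C * u)%R.
  apply: eq_eseriesr => k _; rewrite ger0_norm; last by case/andP: (y01 k).
  by rewrite /y -mulrA -invfM.
have yK u : 1 <= u ->
    (orlicz_modular N (x ord0) (u / (2 * C)) <= K%:E * orlicz_modular N y u)%E.
  move=> u1; have u0 : 0 < u by exact: lt_le_trans u1.
  rewrite yE; apply: orlicz_modular_compare; rewrite ?divr_gt0 ?mulr_gt0 ?(ltW K0)// => k.
  have := NK (`|x ord0 k| / (2 * C * u)).
  have -> : (2 * C) ^+ 2 * (`|x ord0 k| / (2 * C * u)) = `|x ord0 k| / (u / (2 * C)).
    by field; rewrite !gt_eqF.
  apply; rewrite divr_ge0 ?mulr_ge0 ?(ltW C0) ?(ltW u0)//= invfM mulrA ler_pdivrMr// mul1r.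
  by case/andP: (y01 k) => _ /le_trans; apply.
have y1 : (orlicz_modular N y 1 <= 1)%E by rewrite yE mulr1.
have Q0 u : 0 < u -> (0 <= orlicz_modular N y u)%E.
  by move=> u0; apply: nneseries_ge0 => k _ _; exact: (orlicz_term_ge0 NO y k u0).
have [a aE /andP[a0 a1]] := ereal_01_fin (Q0 _ ltr01) y1.
have yt : (orlicz_modular N y t <= 1)%E.
  by apply: le_trans y1; exact: le_orlicz_modular.
have [b bE /andP[b0 b1]] := ereal_01_fin (Q0 _ t0) yt.
exists y, a, b; split=> //.
- have := lt_le_trans h2 (le_trans _ (yK 1 (lexx _))); rewrite mul1r => /(_ (lexx _)).
  by rewrite aE -EFinM lte_fin => /ltW ->/=; rewrite ger_pMr.
- move: h3; rewrite -yE bE -EFinM lee_fin => h3.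
  rewrite mulrAC -mulrA mulrC.
  have -> /= : b * K * m <= K by rewrite mulrAC mulrC ger_pMr// mulrC.
  have : (1 < m%:E * (K%:E * orlicz_modular N y t))%E.
    by apply: (lt_le_trans h4); apply: lee_wpmul2l; rewrite ?lee_fin ?(ltW m0)// yK.
  rewrite bE -!EFinM lte_fin => /ltW; rewrite andbT.
  by have -> : m * (K * b) = b * K * m by ring.
Qed.

(** Dividing y by m^s, with s the reciprocal of p, keeps at least the fraction c m^(-s q) of its
    modular, yet the modular drops to about 1 / m. Hence m^(1 - s q) stays bounded. *)
Lemma crude_pow_minorant p r q : (1 <= p)%E -> pow_minorant N r ->
  crude_sym_fin_rep N p -> pow_minorant N q -> 1 <= reciprocal p * q.
Proof.
move=> p1 Nr pN [c c0 Nq]; have [K K0 H] := crude_modular_growth p1 Nr pN.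
rewrite -subr_le0; apply: (@powR_nat_bounded _ (K / c)) => n.
have [y [a [b []]]] := H n.
set m : R := n.+1%:R; set s := reciprocal p.
move=> y01 aE bE /andP[a1 _] /andP[_ b2].
have m0 : 0 < m by rewrite ltr0n.
have t0 : 0 < m `^ s by rewrite powR_gt0.
have ti01 : 0 < (m `^ s)^-1 <= 1.
  by rewrite invr_gt0 t0/= invf_le1// powR_reciprocal_ge1.
have msq : (m `^ s)^-1 `^ q = m `^ (- (s * q)) by rewrite -powRN -powRrM mulNr.
have ms0 : 0 < m `^ (- (s * q)) by rewrite powR_gt0.
have cmp : (orlicz_modular N y 1 <=
    (c * m `^ (- (s * q)))^-1%:E * orlicz_modular N y (m `^ s))%E.
  apply: orlicz_modular_compare; rewrite ?invr_ge0 ?mulr_ge0 ?(ltW c0) ?(ltW ms0)//.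
  move=> k; rewrite ler_pdivlMl ?mulr_gt0// invr1 mulr1.
  have /andP[y0 y1] := y01 k; rewrite ger0_norm//.
  move: y0; rewrite le_eqVlt => /predU1P[<-|y0].
    by rewrite mul0r orlicz_fun0// mulr0.
  have := Nq (y k) (m `^ s)^-1; rewrite y0 y1 => /(_ isT ti01).
  by rewrite msq; apply: le_trans; rewrite -mulrA [N _ * _]mulrC.
move: cmp; rewrite aE bE -EFinM lee_fin ler_pdivlMl ?mulr_gt0// => cmp.
rewrite powRD; last by rewrite (gt_eqF m0) implybT.
rewrite powRr1 ?(ltW m0)// ler_pdivlMr//.
set X := m `^ (- (s * q)) in cmp ms0 *.
have h1 : c * X <= K * (c * X * a).
  by rewrite mulrCA -[leLHS]mulr1 ler_pM2l// mulr_gt0.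
have h2 : K * (c * X * a) <= K * b by rewrite ler_pM2l.
have h3 : m * (c * X) <= m * K * b.
  by rewrite -mulrA ler_pM2l// (le_trans h1).
by rewrite -mulrA [X * c]mulrC; exact: le_trans b2.
Qed.

(** Dually, the modular drops at least by a factor comparable to m^(s q), so m^(s q - 1) stays
    bounded. *)
Lemma crude_pow_majorant p r q : (1 <= p)%E -> pow_minorant N r ->
  crude_sym_fin_rep N p -> pow_majorant N q -> reciprocal p * q <= 1.
Proof.
move=> p1 Nr pN [c c0 Nq]; have [K K0 H] := crude_modular_growth p1 Nr pN.
rewrite -subr_le0; apply: (@powR_nat_bounded _ (K * c)) => n.
have [y [a [b []]]] := H n.
set m : R := n.+1%:R; set s := reciprocal p.
move=> y01 aE bE /andP[_ a2] /andP[b1 _].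
have m0 : 0 < m by rewrite ltr0n.
have t0 : 0 < m `^ s by rewrite powR_gt0.
have ti01 : 0 < (m `^ s)^-1 <= 1 by rewrite invr_gt0 t0/= invf_le1// powR_reciprocal_ge1.
have msq : (m `^ s)^-1 `^ q = (m `^ (s * q))^-1.
  by rewrite -powRN -powRrM mulNr powRN.
have ms0 : 0 < m `^ (s * q) by rewrite powR_gt0.
have cmp : (orlicz_modular N y (m `^ s) <=
    (c / m `^ (s * q))%:E * orlicz_modular N y 1)%E.
  apply: orlicz_modular_compare; rewrite ?divr_ge0 ?(ltW c0) ?(ltW ms0)//.
  move=> k; rewrite invr1 mulr1.
  have /andP[y0 y1] := y01 k; rewrite ger0_norm//.
  move: y0; rewrite le_eqVlt => /predU1P[<-|y0].
    by rewrite mul0r orlicz_fun0// mulr0.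
  have := Nq (y k) (m `^ s)^-1; rewrite y0 y1 => /(_ isT ti01).
  by rewrite msq => /le_trans; apply; rewrite -mulrA [N _ * _]mulrC.
move: cmp; rewrite aE bE -EFinM lee_fin => cmp.
rewrite powRD; last by rewrite (gt_eqF m0) implybT.
rewrite powRN powRr1 ?(ltW m0)// ler_pdivrMr//.
set X := m `^ (s * q) in cmp ms0 *.
have h1 : m * K * b <= m * K * (c / X * a) by rewrite ler_pM2l// mulr_gt0.
have h2 : c / X * (K * a) <= c / X * K by rewrite ler_pM2l// divr_gt0.
have h3 : 1 <= m * (c / X * K).
  apply: (le_trans b1); apply: (le_trans h1); rewrite -mulrA ler_pM2l//.
  by rewrite mulrCA.
have : X <= m * (c * K).
  rewrite -[leLHS]mul1r -ler_pdivlMr//; apply: (le_trans h3).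
  by rewrite le_eqVlt; apply/orP; left; apply/eqP; ring.
by have -> : m * (c * K) = K * c * m by ring.
Qed.

End CrudeRepresentation.

(** * The equivalences *)

Section Representability.
Variables (R : realType) (N : R -> R).
Hypotheses (NO : orlicz_fun N) (N1 : N 1 = 1).
Implicit Types (p : \bar R) (q e : R).

Lemma sym_block_fin_rep_sym p : sym_block_fin_rep N p -> sym_fin_rep N p.
Proof.
move=> H n e e0; have [m [alpha [_ mS mperm ml]]] := H n e e0.
have m_mono i j : (i <= j <= n)%N -> (m i <= m j)%N.
  move=> /andP[ij jn]; elim: j ij jn => [|j IH]; first by rewrite leqn0 => /eqP ->.
  rewrite leq_eqVlt => /predU1P[->//|]; rewrite ltnS => ij jn.
  by rewrite (leq_trans (IH ij (ltnW jn)))// ltnW// mS.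
exists (fun k => block alpha (m k) (m k.+1)); split=> //; split.
- move=> k; apply: (@in_lN_finite _ _ NO _ (m k.+1)) => // i mi.
  by rewrite /block [(i < _)%N]ltnNge mi andbF.
- have disj (j k : 'I_n) i : (j < k)%N ->
      block alpha (m j) (m j.+1) i = 0 \/ block alpha (m k) (m k.+1) i = 0.
    move=> jk; rewrite /block; case: (ltnP i (m j.+1)) => h; last by left; rewrite andbF.
    right; rewrite [(m k <= i)%N]leqNgt (leq_trans h)//.
    by apply: m_mono; rewrite jk ltnW.
  move=> j k; rewrite -val_eqE neq_ltn => /orP[jk|kj] i; first exact: disj.
  by rewrite or_comm; exact: disj.
- move=> j k; have [mE mP] := mperm j k.
  by apply: block_same_odist => //; rewrite ltnW// mS.
Qed.

Lemma sym_fin_rep_crude p : sym_fin_rep N p -> crude_sym_fin_rep N p.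
Proof.
move=> H; exists (1 + 1); split; first by rewrite addr_gt0.
by move=> n; exact: H.
Qed.

Lemma boyd_alpha_gt0 r : 0 < r -> pow_minorant N r -> 0 < boyd_alpha N.
Proof.
move=> r0 /(pow_minorant_boyd_alpha NO N1 r0); apply: lt_le_trans.
by rewrite invr_gt0.
Qed.

(** Otherwise the power r + 1 would majorize N, which contradicts the minorant t^r at s = 1 once K t
    < c. *)
Lemma boyd_beta_gt0 r : 0 < r -> pow_minorant N r -> 0 < boyd_beta N.
Proof.
move=> r0 [c c0 Nr]; rewrite ltNge; apply/negP => b0.
have r1 : 0 < r + 1 by lra.
have [||K K0] := @boyd_beta_pow_majorant _ _ NO N1 (r + 1)^-1.
- by rewrite invr_gt0.
- by rewrite (le_lt_trans b0)// invr_gt0.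
rewrite invrK => NK.
pose t := Num.min 1 (c / (2 * K)).
have t01 : 0 < t <= 1 by rewrite /t lt_min ge_min lexx ltr01/= divr_gt0// mulr_gt0.
have h01 : 0 < (1 : R) <= 1 by rewrite ltr01 lexx.
have t0 : 0 < t by case/andP: t01.
have := le_trans (Nr 1 t h01 t01) (NK 1 t h01 t01).
rewrite N1 !mul1r powRD ?gt_eqF ?implybT// powRr1 ?(ltW t0)//.
rewrite mulrCA mulrC ler_pM2l ?powR_gt0//.
apply/negP; rewrite -ltNge.
have : t <= c / (2 * K) by rewrite /t ge_min lexx orbT.
rewrite ler_pdivlMr ?mulr_gt0// => h; lra.
Qed.

(** The claim is proved as alpha <= 1/p <= beta. As alpha > 0, this also rules out infinite p. *)
Lemma crude_sym_fin_rep_boyd p r : (1 <= p)%E -> 0 < r -> pow_minorant N r ->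
  crude_sym_fin_rep N p ->
  (inv_ext (boyd_beta N) <= p <= inv_ext (boyd_alpha N))%E.
Proof.
move=> p1 r0 Nr pN.
have a0 := boyd_alpha_gt0 r0 Nr; have b0 := boyd_beta_gt0 r0 Nr.
have as_ : boyd_alpha N <= reciprocal p.
  apply: contrapT => /negP; rewrite -ltNge => sa.
  have [a [pa [a1 a2]]] : exists a, [/\ 0 < a, reciprocal p < a & a < boyd_alpha N].
    exists (Num.max ((reciprocal p + boyd_alpha N) / 2) (boyd_alpha N / 2)).
    rewrite !lt_max gt_max; split; last by apply/andP; split; lra.
      by apply/orP; right; lra.
    by apply/orP; left; lra.
  have := crude_pow_minorant NO N1 p1 Nr pN (boyd_alpha_pow_minorant NO N1 pa a2).
  by rewrite ler_pdivlMr// mul1r leNgt a1.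
have sb : reciprocal p <= boyd_beta N.
  apply: le_eps_pos => e e0; have b1 : boyd_beta N < boyd_beta N + e by lra.
  have be0 : 0 < boyd_beta N + e by lra.
  have := crude_pow_majorant NO N1 p1 Nr pN (boyd_beta_pow_majorant NO N1 be0 b1).
  by rewrite ler_pdivrMr// mul1r.
have s0 : 0 < reciprocal p by exact: lt_le_trans as_.
rewrite /inv_ext !gt_eqF//.
case: p p1 s0 as_ sb {pN} => [q|/=|//]; last by rewrite ltxx.
rewrite /= => q1; rewrite invr_gt0 => q0 aq qb.
rewrite !lee_fin; apply/andP; split.
  by rewrite -[leRHS]invrK lef_pV2 ?posrE ?invr_gt0.
by rewrite -[leLHS]invrK lef_pV2 ?posrE ?invr_gt0.
Qed.

Lemma boyd_no_pow_growth q r : 0 < q -> 0 < r -> pow_minorant N r ->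
  (inv_ext (boyd_beta N) <= q%:E <= inv_ext (boyd_alpha N))%E ->
  (forall q', 0 < q' < q -> ~ pow_minorant N q') /\
  (forall q', q < q' -> ~ pow_majorant N q').
Proof.
move=> q0 r0 Nr.
have a0 := boyd_alpha_gt0 r0 Nr; have b0 := boyd_beta_gt0 r0 Nr.
rewrite /inv_ext !gt_eqF// !lee_fin => /andP[bq qa]; split=> q'.
  move=> /andP[q'0 q'q] /(pow_minorant_boyd_alpha NO N1 q'0) q'a.
  have := lt_le_trans q'q qa; rewrite ltNge => /negP; apply.
  by rewrite -[leRHS]invrK lef_pV2 ?posrE ?invr_gt0.
move=> qq' Nq'; have q'0 : 0 < q' by exact: lt_trans qq'.
have bq' := pow_majorant_boyd_beta NO N1 q'0 Nq'.
have := le_lt_trans bq qq'; rewrite ltNge => /negP; apply.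
by rewrite -[leLHS]invrK lef_pV2 ?posrE ?invr_gt0.
Qed.

Lemma boyd_sym_block_fin_rep p r : (1 <= p)%E -> 0 < r -> pow_minorant N r ->
  (inv_ext (boyd_beta N) <= p <= inv_ext (boyd_alpha N))%E -> sym_block_fin_rep N p.
Proof.
move=> p1 r0 Nr; have a0 := boyd_alpha_gt0 r0 Nr.
case: p p1 => [q|_|//]; last first.
  by rewrite /inv_ext (gt_eqF a0) leye_eq andbF.
rewrite lee_fin => q1; have q0 : 0 < q by exact: lt_le_trans q1.
move=> /(boyd_no_pow_growth q0 r0 Nr)[nmin nmaj] n eps eps0.
(* With the leading constant 1 + 2e the norm lands in [T, (1 + eps) T], so the
   approximation is only needed on [0, 1]. *)
pose e := eps / (3 + eps).
have e0 : 0 < e by rewrite divr_gt0//; lra.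
have A0 : 0 < 1 + 2 * e by lra.
(* The n coordinates together then contribute an error of at most e; n + 1 avoids dividing by
   zero. *)
have en0 : 0 < e / n.+1%:R by rewrite divr_gt0.
have [xs [xs0 xsA]] := pow_approx NO N1 Nr q0 A0 en0 nmin nmaj.
set L := size xs.
have L0 : (0 < L)%N.
  rewrite lt0n size_eq0; apply/negP => /eqP xsE.
  have := xsA 1; rewrite xsE big_nil powR1 mulr1 ler01 lexx => /(_ isT).
  rewrite sub0r normrN ger0_norm ?(ltW A0)// ler_pdivlMr// -natr1.
  have : 0 <= n%:R * (1 + 2 * e) :> R by rewrite mulr_ge0// ltW.
  lra.
(* The periodic extension makes every window of length L starting at a multiple of L list [xs]. *)
pose alpha i := nth 0 xs (i %% L).
have alphaE k : [seq alpha i | i <- iota (k * L) L] = xs.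
  rewrite -[(k * L)%N]addn0 iotaDl -map_comp.
  rewrite -[RHS](mkseq_nth 0) /mkseq -/L; apply/eq_in_map => i.
  by rewrite mem_iota add0n /= /alpha addnC => iL; rewrite addnC modnMDl modn_small.
have kL k : (k.+1 * L - k * L = L)%N by rewrite mulSn addnK.
exists (fun k => k * L)%N, alpha; split.
- by [].
- by move=> k _; rewrite ltn_pmul2r.
- by move=> j k; rewrite !kL !alphaE.
move=> a; set X := fun k : 'I_n => _; set T := lp_norm _ a.
have XD j k : j != k -> forall i, X j i = 0 \/ X k i = 0.
  move=> jk i; rewrite /X /block.
  case: ifPn => [/andP[j1 j2]|]; last by left.
  case: ifPn => [/andP[k1 k2]|]; last by right.
  move: jk; rewrite -val_eqE neq_ltn => /orP[] h.
    by move: (leq_trans j2 (leq_trans (leq_mul h (leqnn L)) k1)); rewrite ltnn.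
  by move: (leq_trans k2 (leq_trans (leq_mul h (leqnn L)) j1)); rewrite ltnn.
have modE u : 0 < u -> orlicz_modular N (lincomb a X) u =
    (\sum_(k < n) \sum_(x <- xs) N (`|a k| / u * x))%:E.
  move=> u0; rewrite orlicz_modular_lincomb// -sumEFin; apply: eq_bigr => k _.
  rewrite orlicz_modular_block// ?leq_mul//; congr (_%:E).
  rewrite -[in RHS](alphaE k) big_map /index_iota kL big_seq [RHS]big_seq.
  apply: eq_bigr => i _; rewrite normrM (ger0_norm (_ : 0 <= alpha i)); last first.
    by rewrite /alpha (all_nthP 0 xs0)// ltn_mod.
  by rewrite mulrAC.
have modA u : 0 < u -> (forall k, `|a k| <= u) ->
    `|\sum_(k < n) \sum_(x <- xs) N (`|a k| / u * x)
      - (1 + 2 * e) * \sum_(k < n) (`|a k| / u) `^ q| <= e.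
  move=> u0 au; rewrite mulr_sumr -sumrB; apply: (le_trans (ler_norm_sum _ _ _)).
  apply: (@le_trans _ _ (\sum_(k < n) e / n.+1%:R)).
    apply: ler_sum => k _; apply: xsA.
    by rewrite divr_ge0 ?(ltW u0)//= ler_pdivrMr// mul1r.
  rewrite sumr_const card_ord -[leLHS]mulr_natr mulrAC ler_pdivrMr// ler_wpM2l ?(ltW e0)//.
  by rewrite ler_nat.
pose S := \sum_(k < n) `|a k| `^ q.
have S0 : 0 <= S by apply: sumr_ge0 => k _; exact: powR_ge0.
have TE : T = S `^ q^-1 by [].
have T0 : 0 <= T by rewrite TE powR_ge0.
have TS : T `^ q = S by rewrite TE -powRrM mulVf ?gt_eqF// powRr1.
have aT k : `|a k| <= T.
  rewrite TE; apply: powR_le_root => //.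
  by rewrite /S (bigD1 k)//= lerDl sumr_ge0// => i _; exact: powR_ge0.
have eps1 : 0 < 1 + eps by lra.
have [TZ|TN] := eqVneq T 0.
  have aZ k : `|a k| = 0 by apply/eqP; rewrite eq_le normr_ge0 -TZ aT.
  suff -> : lN_norm N (lincomb a X) = 0 by rewrite TZ !mulr0 lexx.
  apply/eqP; rewrite eq_le lN_norm_ge0 andbT; apply: le_eps_pos => d d0.
  rewrite add0r; apply: lN_norm_le => //; rewrite modE// lee_fin big1// => k _.
  by rewrite big1// => x _; rewrite aZ !mul0r orlicz_fun0.
have {}T0 : 0 < T by rewrite lt_neqAle eq_sym TN.
have sumT u : 0 < u -> \sum_(k < n) (`|a k| / u) `^ q = (T / u) `^ q.
  move=> u0; rewrite powRM ?invr_ge0 ?(ltW u0) ?(ltW T0)// TS /S mulr_suml.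
  by apply: eq_bigr => k _; rewrite powRM ?invr_ge0 ?(ltW u0).
have u0 : 0 < (1 + eps) * T by rewrite mulr_gt0.
have up : (orlicz_modular N (lincomb a X) ((1 + eps) * T) <= 1)%E.
  rewrite modE// lee_fin.
  have auT k : `|a k| <= (1 + eps) * T.
    by apply: (le_trans (aT k)); rewrite ler_peMl ?(ltW T0)//; lra.
  have := modA _ u0 auT; rewrite sumT//.
  (* Since q >= 1, the q-th power may be replaced by the first; the value of e makes (1 + 2 e) / (1
     + eps) + e equal to 1. *)
  have -> : T / ((1 + eps) * T) = (1 + eps)^-1 by field; rewrite !gt_eqF.
  set Y := \sum_(k < n) _; rewrite ler_norml => /andP[_ h].
  have h1 : (1 + eps)^-1 `^ q <= (1 + eps)^-1.
    by apply: ge1r_powR => //; rewrite invr_gt0 eps1 invf_le1//; lra.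
  have h2 : (1 + 2 * e) * (1 + eps)^-1 `^ q <= (1 + 2 * e) / (1 + eps) by rewrite ler_pM2l.
  have : (1 + 2 * e) / (1 + eps) + e = 1.
    by rewrite /e; field; rewrite !gt_eqF//; lra.
  lra.
apply/andP; split; last exact: lN_norm_le.
apply: (@le_trans _ _ T).
  by rewrite ler_piMl ?(ltW T0)// invf_le1//; lra.
(* At scale T the modular is at least 1 + 2 e - e > 1. *)
apply: (lN_norm_ge NO T0 _ u0 up).
rewrite modE// lte_fin; have := modA _ T0 aT; rewrite sumT// divff// powR1 mulr1.
rewrite ler_norml => /andP[h _]; lra.
Qed.

End Representability.

Theorem theorem6p2 (R : realType) (N : R -> R) (r : R) (p : \bar R) :
  orlicz_fun N -> N 1 = 1 -> 0 < r ->
  (exists c : R, 0 < c /\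
     forall s t : R, 0 < s <= 1 -> 0 < t <= 1 -> c * (N s * t `^ r) <= N (s * t)) ->
  (1 <= p)%E ->
  [/\ (sym_block_fin_rep N p <-> sym_fin_rep N p),
      (sym_fin_rep N p <-> crude_sym_fin_rep N p) &
      (crude_sym_fin_rep N p <->
         (inv_ext (boyd_beta N) <= p <= inv_ext (boyd_alpha N))%E)].
Proof.
move=> NO N1 r0 [c [c0 Nr]] p1.
have {c c0} Nr : pow_minorant N r by exists c.
have i_ii := @sym_block_fin_rep_sym _ _ NO N1 p.
have ii_iii := @sym_fin_rep_crude _ N p.
have iii_iv := crude_sym_fin_rep_boyd NO N1 p1 r0 Nr.
have iv_i := boyd_sym_block_fin_rep NO N1 p1 r0 Nr.
split; split.
- exact: i_ii.
- by move=> /ii_iii/iii_iv/iv_i.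
- exact: ii_iii.
- by move=> /iii_iv/iv_i/i_ii.
- exact: iii_iv.
- by move=> /iv_i/i_ii/ii_iii.
Qed.
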